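(* Let $P$ be a subfactor planar algebra whose annular multiplicity sequence begins $0^{n-1}e$, let $\mathfrak B$ be an orthonormal basis of self-adjoint rotation eigenvectors of the orthogonal complement of $TL_n$ in $P_{n,+}$, with $\rho(R)=\omega_RR$ for $R\in\mathfrak B$, and let $P_{\mathfrak T}$ denote orthogonal projection onto the span $\mathfrak T$ of all Temperley–Lieb diagrams in the $(n+1)$-box space. Then for $S,T\in\mathfrak B$, $$P_{\mathfrak T}(S\circ T)=\begin{cases}\dfrac{p_{n+1}}{[n+2]}&\text{if }S=T,\\0&\text{otherwise,}\end{cases}\qquad P_{\mathfrak T}(S\star T)=\begin{cases}\dfrac{\omega_S\,\mathcal F(p_{n+1})}{[n+2]}&\text{if }S=T,\\0&\text{otherwise,}\end{cases}$$ and for every integer $j$, $P_{\mathfrak T}(\mathcal F^j(S\circ T))=\mathcal F^j(P_{\mathfrak T}(S\circ T))$.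
   Context: Planar algebras. A planar $k$-tangle is a disc with $2k$ marked boundary points and finitely many interior input discs, each with an even number of marked points, all marked points being joined by disjoint strings in the complement of the input discs (closed strings allowed); regions are shaded alternately and each disc has a distinguished boundary interval, marked $*$. A disc has sign $+$ if its distinguished interval is unshaded and $-$ if it is shaded. Points of a disc are numbered clockwise from $*$. A (unital, shaded) planar algebra consists of vector spaces $P_{k,\pm}$ and, for each tangle $T$, a multilinear map $Z_T$ from the spaces of the input discs to that of the outer disc, invariant under orientation-preserving diffeomorphisms and compatible with gluing. A subfactor planar algebra is such an object over $\mathbb C$ with all $P_{k,\pm}$ finite dimensional, $\dim P_{0,\pm}=1$, spherically invariant partition function of closed labelled tangles, and conjugate-linear involutions $*$ on each $P_{k,\pm}$ compatible with orientation-reversing diffeomorphisms of tangles, such that $\langle x,y\rangle=Tr(x^*y)$ (linear in the second variable) is positive definite. Elements of $P_{k,\pm}$ are drawn as boxes with $k$ points on top, $k$ on the bottom and $*$ on the left; the product $xy$ is obtained by stacking $y$ on top of $x$; $Tr(x)$ joins point $j$ to point $2k+1-j$. The parameter $\delta$ is the value of a closed string; $\delta=q+q^{-1}$, $[m]=\frac{q^m-q^{-m}}{q-q^{-1}}$. $TL_k\subseteq P_{k,\pm}$ is the span of tangles with no input discs; $P_k=P_{k,+}$. Annular multiplicities: $a_k=\dim P_k-\dim AC_k$ with $AC_k$ the image in $P_k$ of the $P_j$, $j<k$, under annular tangles (one input disc); the sequence beginning $0^{n-1}e$ means $a_k=0$ for $1\le k<n$, $a_n=e$. Fourier transform $\mathcal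 F:P_{k,\pm}\to P_{k,\mp}$: the annular tangle with one input disc and $2k$ strings joining it to the outer boundary without caps, in which the $*$ of the input disc is one interval clockwise from the $*$ of the outer disc. Rotation: $\rho=\mathcal F^2$. On Temperley–Lieb elements one identifies diagrams in $P_{k,+}$ and $P_{k,-}$ by reversing the shading, so $\mathcal F$ is also regarded as a map $TL_k\to TL_k$; $\mathfrak T$ is the span of Temperley–Lieb diagrams in $P_{n+1,+}$ (or in $P_{n+1,-}$ when the element projected lies there). The Jones–Wenzl projection $p_k\in TL_k$ is the projection with $E_ip_k=p_kE_i=0$ for $1\le i<k$ and coefficient $1$ on the identity diagram, where $E_i$ has a cup and a cap at positions $i,i+1$ and vertical strings elsewhere. For $S,T\in P_n$, $S\circ T\in P_{n+1,+}$ is the tangle with $S$ below $T$, all $*$'s in the same left-hand region, point $j$ of $S$ joined to point $2n+1-j$ of $T$ for $1\le j\le n-1$; points $1,\dots,n+1$ of $T$ are joined to outer points $1,\dots,n+1$ and points $n,\dots,2n$ of $S$ to outer points $n+2,\dots,2n+2$. The same tangle with reversed shading defines $\circ$ on $P_{n,-}$. $S\star T=\mathcal F(\mathcal F(S)\circ\mathcal F(T))$. *)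

(* Defs.v *)
From HB Require Import structures.
From mathcomp Require Import all_boot all_order all_algebra.
From mathcomp Require Import boolp classical_sets reals.
From mathcomp Require Import complex zify.

Set Implicit Arguments.
Unset Strict Implicit.
Unset Printing Implicit Defensive.

Import Order.TTheory GRing.Theory Num.Theory.

Local Open Scope ring_scope.

(** * Labelled planar tangles

  A tangle is given by a picture in a rectangle, in generic position for the
  height function, read from bottom to top as a sequence of layers.  A layer
  [(a, g)] consists of one elementary piece [g] with [a] vertical strings on its
  left and any number of vertical strings on its right.  An input disc with [2k]
  marked points is a box with [k] points on top, [k] on the bottom and its
  distinguished interval * on the left; it carries its label, an element of
  [L k s] where [s] is the sign of the disc.  The outer disc is the rectangle,
  with * on the left.  Every planar tangle can be isotoped to such a picture,
  and two pictures represent the same tangle iff they are related by the moves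
  [move] below.

  Signs: [true] is + (distinguished interval unshaded), [false] is -.
  Clockwise numbering from *: the points 1, ..., k are the top points from left
  to right and k+1, ..., 2k are the bottom points from right to left. *)

Inductive piece (L : nat -> bool -> Type) : Type :=
| Cup                                   (* local minimum: creates two strings *)
| Cap                                   (* local maximum: joins two strings *)
| Box (k : nat) (s : bool) (x : L k s).
Arguments Cup {L}.
Arguments Cap {L}.
Arguments Box {L k s} x.

Definition tangle (L : nat -> bool -> Type) := seq (nat * piece L).

Definition nin L (g : piece L) : nat :=
  match g with Cup => 0 | Cap => 2 | @Box _ k _ _ => k end.

Definition nout L (g : piece L) : nat :=
  match g with Cup => 2 | Cap => 0 | @Box _ k _ _ => k end.

(* Regions are shaded alternately: the region which has [a] strings between it
   and a left-hand region of sign [s] has sign [shade s a]. *)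
Definition shade (s : bool) (a : nat) : bool := s (+) odd a.

Definition sign_ok L (s : bool) (g : piece L) : bool :=
  if g is @Box _ _ t _ then t == s else true.

(* [wf s m w p]: [w] is a picture with leftmost region of sign [s], with [m]
   strings at the bottom and [p] strings at the top.  The tangles whose outer
   disc has [2k] points and sign [s] are the [w] such that [wf s k w k]. *)
Fixpoint wf L (s : bool) (m : nat) (w : tangle L) (p : nat) : bool :=
  match w with
  | [::] => m == p
  | (a, g) :: w' => [&& (a + nin g <= m)%N, sign_ok (shade s a) g
                      & wf s (m - nin g + nout g) w' p]
  end.

Definition shift L (c : nat) (w : tangle L) : tangle L :=
  [seq ((c + l.1)%N, l.2) | l <- w].

(* No input disc: Temperley-Lieb pictures. *)
Definition boxfree L (w : tangle L) : bool :=
  all (fun l => if l.2 is Box _ _ _ then false else true) w.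

(* [k] nested cups (caps), the outermost one having its left leg at position
   [a]. *)
Definition ncups L (a k : nat) : tangle L :=
  [seq ((a + i)%N, Cup) | i <- iota 0 k].
Definition ncaps L (a k : nat) : tangle L :=
  [seq ((a + i)%N, Cap) | i <- rev (iota 0 k)].

Arguments ncups {L} a k.
Arguments ncaps {L} a k.

(* The elementary moves generating isotopy of pictures (each applied inside a
   larger picture): exchange of the heights of two disjoint pieces, straightening
   of a string, and full rotation of a box, stated as: the rotations of a box by
   half a turn in the two directions agree. *)
Inductive move L : tangle L -> tangle L -> Prop :=
| MoveExchange a c g h :
    move [:: (a, g); (a + nout g + c, h)%N] [:: (a + nin g + c, h)%N; (a, g)]
| MoveZigzag a : move [:: (a, Cup); (a.+1, Cap)] [::]
| MoveZagzig a : move [:: (a.+1, Cup); (a, Cap)] [::]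
| MoveRotate a k s (x : L k s) :
    move (ncups (a + k) k ++ ((a + k)%N, Box x) :: ncaps a k)
         (ncups a k ++ ((a + k)%N, Box x) :: ncaps (a + k) k).

(* Image of a picture under the reflection in a horizontal line, with [f] applied
   to the labels. *)
Definition mirror_piece L (f : forall k s, L k s -> L k s) (g : piece L) :=
  match g with
  | Cup => Cap
  | Cap => Cup
  | @Box _ k s x => Box (f k s x)
  end.
Definition mirror L (f : forall k s, L k s -> L k s) (w : tangle L) : tangle L :=
  rev [seq (l.1, mirror_piece f l.2) | l <- w].

(** * Planar algebras

  [pa_Z k s w] is [Z_T(x_1, ..., x_r)] for [w] the tangle [T] labelled by the
  [x_i]; it is only meaningful when [wf s k w k].  All the spaces are finite
  dimensional, as required of subfactor planar algebras. *)
Record planarAlgebra (C : fieldType) := PlanarAlgebra {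
  pa_space :> nat -> bool -> vectType C;
  pa_Z : forall k s, tangle pa_space -> pa_space k s;
  pa_linear : forall k s (w1 w2 : tangle pa_space) a j t c
      (x y : pa_space j t),
    wf s k (w1 ++ (a, Box x) :: w2) k ->
    pa_Z k s (w1 ++ (a, Box (c *: x + y)) :: w2) =
      c *: pa_Z k s (w1 ++ (a, Box x) :: w2)
      + pa_Z k s (w1 ++ (a, Box y) :: w2);
  pa_isotopy : forall k s (w1 w2 u v : tangle pa_space),
    move u v ->
    wf s k (w1 ++ u ++ w2) k -> wf s k (w1 ++ v ++ w2) k ->
    pa_Z k s (w1 ++ u ++ w2) = pa_Z k s (w1 ++ v ++ w2);
  pa_gluing : forall k s (w1 w2 u : tangle pa_space) a j t,
    wf s k (w1 ++ (a, Box (pa_Z j t u)) :: w2) k -> wf t j u j ->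
    pa_Z k s (w1 ++ (a, Box (pa_Z j t u)) :: w2) =
      pa_Z k s (w1 ++ shift a u ++ w2);
  pa_unit : forall k s (x : pa_space k s), pa_Z k s [:: (0%N, Box x)] = x
}.
Arguments pa_Z {C} p k s w.

Notation ptangle P := (tangle (pa_space P)).

Section Elements.
Context {C : fieldType} {P : planarAlgebra C}.
Implicit Types (k n : nat) (s : bool).

(* The partition function of closed tangles: the scalar [c] such that [x] is [c]
   times the empty tangle, when [P 0 s] is one dimensional. *)
Definition scal s (x : P 0%N s) : C := coord [tuple pa_Z P 0%N s [::]] ord0 x.

(* The product [xy] has [y] on top of [x]. *)
Definition mul k s (x y : P k s) : P k s :=
  pa_Z P k s [:: (0%N, Box x); (0%N, Box y)].

Definition one k s : P k s := pa_Z P k s [::].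

Definition Tr k s (x : P k s) : C :=
  scal (pa_Z P 0%N s (ncups 0 k ++ (0%N, Box x) :: ncaps 0 k)).

Definition E k s (i : nat) : P k s := pa_Z P k s [:: (i, Cap); (i, Cup)].

(* Input point [j] is joined to outer point [j+1], and input point [2k] to outer
   point 1.  For [0 < k] only. *)
Definition fourier k s (x : P k s) : P k (~~ s) :=
  pa_Z P k (~~ s) [:: (0%N, Cup); (1%N, Box x); (k, Cap)].

(* The same with [j-1] in place of [j+1]; it is the inverse of [fourier], by
   [fourier_invK] below. *)
Definition fourier_inv k s (x : P k s) : P k (~~ s) :=
  pa_Z P k (~~ s) [:: (k, Cup); (1%N, Box x); (0%N, Cap)].

Fixpoint fourier_iter (j : nat) k s (x : P k s) : P k (iter j negb s) :=
  if j is j'.+1 then fourier (fourier_iter j' x) else x.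

Fixpoint fourier_inv_iter (j : nat) k s (x : P k s) : P k (iter j negb s) :=
  if j is j'.+1 then fourier_inv (fourier_inv_iter j' x) else x.

Definition fourier_pow (j : int) k s (x : P k s) : P k (iter `|j|%N negb s) :=
  match j return P k (iter `|j|%N negb s) with
  | Posz m => fourier_iter m x
  | Negz m => fourier_inv_iter m.+1 x
  end.

Definition rotation k (x : P k true) : P k true := fourier (fourier x).

(* [S] is below [T]; the last string of the bottom is joined to the rightmost top
   point of [S] and the last string of the top to the rightmost bottom point of
   [T].  For [0 < n] only. *)
Definition circ n s (S T : P n s) : P n.+1 s :=
  pa_Z P n.+1 s [:: (0%N, Box S); (n.-1, Cap); (n.-1, Cup); (0%N, Box T)].

Definition bstar n (S T : P n true) : P n.+1 true :=
  fourier (circ (fourier S) (fourier T)).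

End Elements.

Arguments one {C} P k s.
Arguments E {C} P k s i.

Record subfactorPlanarAlgebra (C : numClosedFieldType) := SubfactorPlanarAlgebra {
  spa_pa :> planarAlgebra C;
  star : forall k s, spa_pa k s -> spa_pa k s;
  spa_dim0 : forall s, \dim {: spa_pa 0%N s} = 1%N;
  (* A string can be moved over the point at infinity: the two closures of a
     tangle with one string at the bottom and one at the top agree. *)
  spa_spherical : forall s (w : ptangle spa_pa), wf s 1%N w 1%N ->
    scal (pa_Z spa_pa 0%N s ((0%N, Cup) :: w ++ [:: (0%N, Cap)]))
    = scal (pa_Z spa_pa 0%N (~~ s) ((0%N, Cup) :: shift 1%N w ++ [:: (0%N, Cap)]));
  spa_star_linear : forall k s c (x y : spa_pa k s),
    star (c *: x + y) = c^* *: star x + star y;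
  spa_starK : forall k s (x : spa_pa k s), star (star x) = x;
  (* As every orientation-reversing diffeomorphism is the composite of a
     reflection and an orientation-preserving one, it suffices to consider
     [mirror]. *)
  spa_star_Z : forall k s (w : ptangle spa_pa), wf s k w k ->
    star (pa_Z spa_pa k s w) = pa_Z spa_pa k s (mirror star w);
  spa_pos : forall k s (x : spa_pa k s), x != 0 -> 0 < Tr (mul (star x) x)
}.
Arguments star {C P k s} x : rename.

(* The linear span of an arbitrary set of vectors. *)
Definition span_of (C : fieldType) (V : vectType C) (A : set V) : {vspace V} :=
  xget 0%VS [set U : {vspace V} | (forall v, A v -> v \in U) /\
     forall W : {vspace V}, (forall v, A v -> v \in W) -> (U <= W)%VS]%classic.

Section Subfactor.
Context {C : numClosedFieldType} (P : subfactorPlanarAlgebra C).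
Implicit Types (k n : nat) (s : bool).

Definition inner k s (x y : P k s) : C := Tr (mul (star x) y).

Definition delta : C := scal (pa_Z P 0%N true [:: (0%N, Cup); (0%N, Cap)]).

Definition orthocompl k s (U : {vspace P k s}) : {vspace P k s} :=
  span_of [set x | forall u, u \in U -> inner u x = 0]%classic.

Definition orthoproj k s (U : {vspace P k s}) : P k s -> P k s :=
  daddv_pi U (orthocompl U).

Definition TL k s : {vspace P k s} :=
  span_of [set x | exists w : ptangle P,
    [/\ boxfree w, wf s k w k & x = pa_Z P k s w]]%classic.

(* The span of the Temperley-Lieb diagrams other than the identity, i.e. of those
   with fewer than [k] through strings; these are the diagrams which can be cut
   horizontally along fewer than [k] strings. *)
Definition TLlow k s : {vspace P k s} :=
  span_of [set x | exists m (u v : ptangle P),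
    [/\ (m < k)%N, boxfree (u ++ v), wf s k u m, wf s m v k
      & x = pa_Z P k s (u ++ v)]]%classic.

(* The condition [p - one P k s \in TLlow k s] says that [p] has coefficient 1 on
   the identity diagram. *)
Definition is_jones_wenzl k s (p : P k s) : Prop :=
  [/\ p \in TL k s, mul p p = p, star p = p,
      forall i, (i.+1 < k)%N -> mul (E P k s i) p = 0 /\ mul p (E P k s i) = 0
    & p - one P k s \in TLlow k s].

Definition jones_wenzl k s : P k s := xget 0 [set p | is_jones_wenzl p]%classic.

Definition AC k : {vspace P k true} :=
  span_of [set y | exists j (x : P j true) a (u v : ptangle P),
    [/\ (j < k)%N, boxfree (u ++ v), wf true k (u ++ (a, Box x) :: v) k
      & y = pa_Z P k true (u ++ (a, Box x) :: v)]]%classic.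

Definition annular_mult k : nat := (\dim {: P k true} - \dim (AC k))%N.

End Subfactor.

(* [m] = (q^m - q^-m) / (q - q^-1), extended by continuity to q = q^-1. *)
Definition qint (C : fieldType) (q : C) (m : nat) : C :=
  if q == q^-1 then q ^+ m.-1 *+ m else (q ^+ m - q ^- m) / (q - q^-1).

(** * The definitions [span_of] and [fourier_inv] are as intended *)

Lemma span_ofP (C : fieldType) (V : vectType C) (A : set V) :
  (forall v, A v -> v \in span_of A) /\
  forall W : {vspace V}, (forall v, A v -> v \in W) -> (span_of A <= W)%VS.
Proof.
rewrite /span_of; case: xgetP => [U _ //|none]; exfalso.
pose good (U : {vspace V}) :=
  forall W : {vspace V}, (forall v, A v -> v \in W) -> (U <= W)%VS.
have step d (U : {vspace V}) : good U -> (\dim {: V} - \dim U <= d)%N -> False.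
  elim: d U => [|d IHd] U gU dU.
    have UV : U = fullv.
      by apply/eqP; rewrite eqEdim subvf -subn_eq0 -leqn0.
    by apply: (none U); split=> // v _; rewrite UV memvf.
  have [AU|/existsNP[v /not_implyP[Av /negP vU]]] :=
    pselect (forall v, A v -> v \in U); first by apply: (none U).
  apply: (IHd (U + <[v]>)%VS) => [W AW|].
    by rewrite subv_add gU // -memvE AW.
  have lt : (\dim U < \dim (U + <[v]>))%N.
    rewrite ltnNge; apply: contra vU => le.
    have /eqP -> : U == (U + <[v]>)%VS by rewrite eqEdim addvSl.
    by rewrite memvE addvSr.
  by rewrite leq_subLR in dU *; lia.
by apply: (step _ 0%VS _ (leqnn _)) => W _; exact: sub0v.
Qed.

Lemma fourier_invK (C : fieldType) (P : planarAlgebra C) k s (x : P k s) :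
  (0 < k)%N -> ecast s (P k s) (negbK s) (fourier (fourier_inv x)) = x.
Proof.
move=> k0; have ds : shade (~~ ~~ s) 2 = s by rewrite /shade; case: s {x}.
suff H : fourier (fourier_inv x) = pa_Z P k (~~ ~~ s) [:: (0%N, Box x)].
  rewrite H; case: s x {H ds} => x;
    by rewrite (eq_irrelevance (negbK _) erefl) /= pa_unit.
rewrite /fourier /fourier_inv.
set u := (X in pa_Z P k (~~ s) X).
have wu : wf (~~ s) k u k.
  by rewrite /u /= /shade /= addbT negbK eqxx; apply/and4P; split; lia.
rewrite (@pa_gluing _ _ _ _ [:: (0%N, Cup)] [:: (k, Cap)] u) //; last first.
  by rewrite /= /shade /= addbT negbK eqxx; apply/and3P; split; lia.
have ex w1 w2 a c g h k' s' : wf s' k' (w1 ++ [:: (a, g); (a + nout g + c, h)%N] ++ w2) k' ->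
   wf s' k' (w1 ++ [:: (a + nin g + c, h)%N; (a, g)] ++ w2) k' -> 
   pa_Z P k' s' (w1 ++ [:: (a, g); (a + nout g + c, h)%N] ++ w2) =
   pa_Z P k' s' (w1 ++ [:: (a + nin g + c, h)%N; (a, g)] ++ w2).
  by move=> *; apply: pa_isotopy => //; exact: MoveExchange.
have sh0 : shade (~~ ~~ s) 0 = s by rewrite /shade negbK addbF.
transitivity (pa_Z P k (~~ ~~ s) [:: (k.-1, Cup); (0%N, Cup); (2%N, Box x); (1%N, Cap); (k, Cap)]).
  have := ex [::] [:: (2%N, Box x); (1%N, Cap); (k, Cap)] 0%N k.-1 Cup Cup k (~~ ~~ s).
  rewrite /u /= !addn0 !add0n add1n (_ : 2 + k.-1 = k.+1)%N; last by lia.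
  by apply; rewrite ds eqxx /=; lia.
transitivity (pa_Z P k (~~ ~~ s) [:: (k.-1, Cup); (0%N, Box x); (0%N, Cup); (1%N, Cap); (k, Cap)]).
  have := ex [:: (k.-1, Cup)] [:: (1%N, Cap); (k, Cap)] 0%N 0%N Cup (Box x) k (~~ ~~ s).
  by rewrite /= !addn0 !add0n ds sh0 eqxx /=; apply; lia.
transitivity (pa_Z P k (~~ ~~ s) [:: (k.-1, Cup); (0%N, Box x); (k, Cap)]).
  have := @pa_isotopy _ P k (~~ ~~ s) [:: (k.-1, Cup); (0%N, Box x)] [:: (k, Cap)] _ _ (MoveZigzag _ 0%N).
  by rewrite /= sh0 eqxx /=; apply; lia.
transitivity (pa_Z P k (~~ ~~ s) [:: (k.-1, Cup); (k, Cap); (0%N, Box x)]).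
  have := ex [:: (k.-1, Cup)] [::] 0%N 0%N (Box x) Cap k (~~ ~~ s).
  by rewrite /= !addn0 !add0n sh0 eqxx /=; apply; lia.
have := @pa_isotopy _ P k (~~ ~~ s) [::] [:: (0%N, Box x)] _ _ (MoveZigzag _ k.-1).
by rewrite /= prednK // sh0 eqxx /=; apply; lia.
Qed.

(* Main.v *)
Require Import Defs.
From HB Require Import structures.
From mathcomp Require Import all_boot all_order all_algebra.
From mathcomp Require Import boolp classical_sets reals.
From mathcomp Require Import complex zify ring.

Set Implicit Arguments.
Unset Strict Implicit.
Unset Printing Implicit Defensive.

Import Order.TTheory GRing.Theory Num.Theory.
Import Defs.

Local Open Scope ring_scope.

(** Write TL for the span of the diagrams without input discs, and let S and T
  be self-adjoint elements of the n-box space that are orthogonal to TL.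

  The element S is uncappable.  Since a_k = 0 for 0 < k < n, every box space of
  size less than n, of either sign, is TL ([annular0_TL]).  Hence capping off S
  gives a TL element; its inner product with itself is the inner product of a
  TL element with S, so it vanishes.  This is done once for the cap that joins
  the last top point to the last bottom point ([perp_ptr]); the other positions
  follow by rotating S ([perp_cup0]).

  A TL diagram with fewer than n + 1 through strings can be drawn so that it
  ends with a cup ([Z_last_cup]).  Under S o T that cup caps off S, either
  directly or through the rightmost string, so S o T is orthogonal to all these
  diagrams ([circ_TLlow]).  The Jones-Wenzl element p is orthogonal to them
  too, and together with the identity they span TL ([TL_split]).  So the
  projection of S o T is the multiple of p with the right inner product with
  the identity, namely Tr(S o T) / Tr(p) = <S, T> / [n + 2] ([circ_perp]).

  That p exists and has trace [n + 2] is Wenzl's recursion, which adds one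
  string at a time and divides by the ratio of two consecutive traces
  ([wenzl_jw], [jw_exists]).  At special values of q the recursion could stop,
  but only if some Jones-Wenzl element vanished, i.e. if the identity were a
  combination of the other diagrams; it would then annihilate S o S, whose
  trace is <S, S> = 1 ([one_notin_low]).  So the existence of S itself
  guarantees that the quantum integers up to [n + 2] are invertible.

  Finally, moving one string over the point at infinity shows that the Fourier
  transform F is unitary ([Tr_fou], [inner_fou]).  As it preserves TL, it
  commutes with the projection.  The formula for the other product comes from
  the first one applied to F(S) and F(T), with
  Tr(F(S) F(T)) = <S, F(F(T))> = omega_T <S, T>. *)

(** * Heights and signs in pictures *)

Section Words.
Context (L : nat -> bool -> Type).
Implicit Types (s : bool) (m p r a b c d : nat) (u v w : tangle L).
Implicit Types g h : piece L.

Lemma wf_cat s m u v p r : wf s m u p -> wf s p v r -> wf s m (u ++ v) r.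
Proof.
elim: u m => [|[a g] u IHu] m /=; first by move/eqP->.
by case/and3P=> -> -> wu wv; exact: IHu.
Qed.

Lemma wf_catE s m u v r :
  wf s m (u ++ v) r -> exists2 p, wf s m u p & wf s p v r.
Proof.
elim: u m => [|[a g] u IHu] m /=; first by exists m.
by case/and3P=> -> -> /IHu.
Qed.

Lemma odd_nin g : odd (nin g) = odd (nout g).
Proof. by case: g. Qed.

Lemma shadeD s a b : shade (shade s a) b = shade s (a + b).
Proof. by rewrite /shade oddD addbA. Qed.

Lemma wf_shift s m w p c d :
  wf (shade s c) m w p -> wf s (c + m + d) (shift c w) (c + p + d).
Proof.
elim: w m => [|[a g] w IHw] m /=; first by move/eqP->.
rewrite shadeD; case/and3P=> le -> /IHw.
have -> : (c + m + d - nin g + nout g = c + (m - nin g + nout g) + d)%N by lia.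
by move->; rewrite andbT; lia.
Qed.

Lemma wf_widen s m w p d : wf s m w p -> wf s (m + d) w (p + d).
Proof.
have -> : s = shade s 0 by rewrite /shade addbF.
move/(wf_shift d) => /=; rewrite !add0n /shift (eq_map (g := id)) ?map_id //.
  by rewrite /shade addbF.
by case.
Qed.

Lemma shift0 w : shift 0 w = w.
Proof. by rewrite /shift (eq_map (g := id)) ?map_id //; case. Qed.

Lemma shift_cat c u v : shift c (u ++ v) = shift c u ++ shift c v.
Proof. exact: map_cat. Qed.

Lemma boxfree_cat u v : boxfree (u ++ v) = boxfree u && boxfree v.
Proof. exact: all_cat. Qed.

Lemma boxfree_shift c w : boxfree (shift c w) = boxfree w.
Proof. by rewrite /boxfree all_map. Qed.

End Words.

(* Well-formedness of an explicit picture is linear arithmetic: comparison of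
   heights and, through the parity in [shade], of signs. *)
Ltac wfs := rewrite /= /shade; lia.

(** * Isotopy as rewriting inside pictures *)

Section Isotopy.
Context {C : fieldType} {P : planarAlgebra C}.
Implicit Types (s t : bool) (m p r a b c d k j : nat) (u v w : ptangle P).
Implicit Types g h : piece (pa_space P).

(** Isotopy is needed only through its effect on values, in an arbitrary
  surrounding picture.  Well-formedness of both sides is part of the relation,
  so that chains of rewriting steps compose without further side conditions. *)
Definition eqv s m p u v : Prop :=
  [/\ wf s m u p, wf s m v p &
      forall k w1 w2, wf s k w1 m -> wf s p w2 k ->
        pa_Z P k s (w1 ++ u ++ w2) = pa_Z P k s (w1 ++ v ++ w2)].

Lemma eqv_refl s m p u : wf s m u p -> eqv s m p u u.
Proof. by []. Qed.

Lemma eqv_sym s m p u v : eqv s m p u v -> eqv s m p v u.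
Proof. by case=> wu wv e; split=> // k w1 w2 w1P w2P; rewrite e. Qed.

Lemma eqv_trans v s m p u w : eqv s m p u v -> eqv s m p v w -> eqv s m p u w.
Proof.
case=> wu wv e [_ ww e']; split=> // k w1 w2 w1P w2P.
by rewrite e // e'.
Qed.

Lemma eqv_cat s m p r u u' v v' :
  eqv s m p u u' -> eqv s p r v v' -> eqv s m r (u ++ v) (u' ++ v').
Proof.
case=> wu wu' eu [wv wv' ev].
split; [exact: wf_cat wu wv | exact: wf_cat wu' wv' |] => k w1 w2 w1P w2P.
rewrite -!catA eu //; last exact: wf_cat w2P.
rewrite catA ev -?catA //; exact: wf_cat wu'.
Qed.

Lemma eqv_head s m p a g u v :
  (a + nin g <= m)%N && sign_ok (shade s a) g ->
  eqv s (m - nin g + nout g) p u v -> eqv s m p ((a, g) :: u) ((a, g) :: v).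
Proof.
move=> ok e; apply: (@eqv_cat s m (m - nin g + nout g)%N p [:: _] [:: _]) => //.
by apply: eqv_refl; rewrite /= andbA ok /=.
Qed.

Lemma eqv_Z s k u v : eqv s k k u v -> pa_Z P k s u = pa_Z P k s v.
Proof.
by case=> _ _ /(_ k [::] [::]); rewrite !cats0; apply; rewrite /=.
Qed.

Lemma eqv_move s m p u v : move u v -> wf s m u p -> wf s m v p -> eqv s m p u v.
Proof.
move=> uv wu wv; split=> // k w1 w2 w1P w2P; apply: pa_isotopy => //.
  exact: wf_cat w1P (wf_cat wu w2P).
exact: wf_cat w1P (wf_cat wv w2P).
Qed.

(** The exchange move with free positions: the move itself fixes them as sums,
  which the positions in actual pictures match only up to arithmetic. *)
Lemma eqv_exch b' s m p a b g h :
  (a + nin g <= b')%N -> (b' + nout g = b + nin g)%N ->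
  wf s m [:: (a, g); (b, h)] p ->
  eqv s m p [:: (a, g); (b, h)] [:: (b', h); (a, g)].
Proof.
move=> le eb wgh; have og := odd_nin g.
have eb1 : (b = a + nout g + (b' - a - nin g))%N by lia.
have eb2 : (b' = a + nin g + (b' - a - nin g))%N by lia.
apply: eqv_move => //; first by rewrite {1}eb2 eb1; exact: MoveExchange.
move: wgh => /= /and5P[le1 sg le2 sh /eqP <-].
have -> : shade s b' = shade s b by rewrite /shade; lia.
by rewrite sg sh /=; lia.
Qed.

Lemma eqv_exch_cons b' w s m p a b g h :
  (a + nin g <= b')%N -> (b' + nout g = b + nin g)%N ->
  wf s m [:: (a, g), (b, h) & w] p ->
  eqv s m p [:: (a, g), (b, h) & w] [:: (b', h), (a, g) & w].
Proof.
move=> le eb /(@wf_catE _ s m [:: (a, g); (b, h)] w) [r r1 r2].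
exact: (eqv_cat (eqv_exch le eb r1) (eqv_refl r2)).
Qed.

Lemma eqv_zigzag w s m p a b : b = a.+1 -> (a < m)%N -> wf s m w p ->
  eqv s m p [:: (a, Cup), (b, Cap) & w] w.
Proof.
move=> -> lt ww; apply: (@eqv_cat s m m p [:: _; _] [::]) => //.
by apply: eqv_move; [exact: MoveZigzag | wfs | wfs].
Qed.

Lemma eqv_zagzig w s m p a b : b = a.+1 -> (a < m)%N -> wf s m w p ->
  eqv s m p [:: (b, Cup), (a, Cap) & w] w.
Proof.
move=> -> lt ww; apply: (@eqv_cat s m m p [:: _; _] [::]) => //.
by apply: eqv_move; [exact: MoveZagzig | wfs | wfs].
Qed.

(** Iterated exchanges: the whole picture [v] lies on the right of the piece, so
  only its positions change. *)
Lemma eqv_slide s m p a g v :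
  wf s m ((a, g) :: shift (a + nout g) v) p ->
  eqv s m p ((a, g) :: shift (a + nout g) v)
            (shift (a + nin g) v ++ [:: (a, g)]).
Proof.
elim: v m => [|[c h] v IHv] m wv; first exact: eqv_refl.
have e : eqv s m p ((a, g) :: shift (a + nout g) ((c, h) :: v))
   [:: ((a + nin g + c)%N, h), (a, g) & shift (a + nout g) v].
  by apply: eqv_exch_cons wv => //=; lia.
apply: (eqv_trans e); case: e => _ + _.
rewrite [wf _ _ _ _]/= andbA => /andP[ok w'].
by apply: eqv_head => //; apply: IHv.
Qed.

Lemma eqv_glue s m a j t u : wf t j u j -> t = shade s a -> (a + j <= m)%N ->
  eqv s m m [:: (a, Box (pa_Z P j t u))] (shift a u).
Proof.
move=> wu et le.
have wb : @wf (pa_space P) s m [:: (a, Box (pa_Z P j t u))] m by rewrite /= et eqxx; lia.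
split=> //.
  have -> : m = (a + j + (m - a - j))%N by lia.
  by apply: wf_shift; rewrite -et.
by move=> k w1 w2 w1P w2P; apply: pa_gluing => //; exact: wf_cat w1P (wf_cat wb w2P).
Qed.

Lemma eqv_glue_cons w s m p a j t u : wf t j u j ->
  @wf (pa_space P) s m ((a, Box (pa_Z P j t u)) :: w) p ->
  eqv s m p ((a, Box (pa_Z P j t u)) :: w) (shift a u ++ w).
Proof.
move=> wu /= /and3P[le /eqP et]; have -> : (m - j + j = m)%N by lia.
by move=> ww; apply: (@eqv_cat s m m p [:: _]) => //; exact: eqv_glue.
Qed.

Lemma wf_label s m p w1 w2 a j t (x y : P j t) :
  @wf (pa_space P) s m (w1 ++ (a, Box x) :: w2) p ->
  @wf (pa_space P) s m (w1 ++ (a, Box y) :: w2) p.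
Proof.
by case/wf_catE=> r w1P w2P; apply: wf_cat w1P _.
Qed.

Lemma Z_box0 k s w1 w2 a j t :
  @wf (pa_space P) s k (w1 ++ (a, Box (0 : P j t)) :: w2) k ->
  pa_Z P k s (w1 ++ (a, Box (0 : P j t)) :: w2) = 0.
Proof.
move=> wk; have := pa_linear (-1) 0 wk; rewrite scaler0 addr0 scaleN1r.
by rewrite addNr.
Qed.

Lemma Z_boxZ k s w1 w2 a j t (c : C) (x : P j t) :
  @wf (pa_space P) s k (w1 ++ (a, Box x) :: w2) k ->
  pa_Z P k s (w1 ++ (a, Box (c *: x)) :: w2) =
    c *: pa_Z P k s (w1 ++ (a, Box x) :: w2).
Proof.
move=> wk; rewrite -[c *: x]addr0 pa_linear // Z_box0 ?addr0 //.
exact: wf_label wk.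
Qed.

End Isotopy.

(** * Spans of arbitrary sets *)

Section Span.
Context {C : fieldType} {V : vectType C}.

Lemma span_of_mem (A : set V) v : A v -> v \in span_of A.
Proof. exact: (span_ofP A).1. Qed.

Lemma span_of_sub (A : set V) (W : {vspace V}) :
  (forall v, A v -> v \in W) -> (span_of A <= W)%VS.
Proof. exact: (span_ofP A).2. Qed.

(** Finite dimension: a finite subfamily of [A] of maximal dimension already
  spans. *)
Lemma span_of_seq (A : set V) :
  exists2 X : seq V, forall x, x \in X -> A x & (span_of A <= <<X>>)%VS.
Proof.
suff step d (X : seq V) : (forall x, x \in X -> A x) ->
    (\dim {: V} - \dim <<X>>%VS <= d)%N ->
    exists2 X : seq V, forall x, x \in X -> A x & (span_of A <= <<X>>)%VS.
  by apply: (step _ [::] _ (leqnn _)) => x.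
elim: d X => [|d IHd] X XA dX.
  exists X => //; suff -> : <<X>>%VS = fullv by exact: subvf.
  by apply/eqP; rewrite eqEdim subvf -subn_eq0 -leqn0.
have [AX|/existsNP[v /not_implyP[Av /negP vX]]] :=
  pselect (forall v, A v -> v \in <<X>>%VS).
  by exists X => //; exact: span_of_sub.
apply: (IHd (v :: X)) => [x|]; first by rewrite inE => /predU1P[->|/XA].
have lt : (\dim <<X>> < \dim <<v :: X>>)%N.
  rewrite ltnNge; apply: contra vX => le; rewrite span_cons in le.
  have /eqP -> : <<X>>%VS == (<[v]> + <<X>>)%VS by rewrite eqEdim addvSr.
  by rewrite memvE addvSl.
by rewrite leq_subLR in dX *; lia.
Qed.

(** Properties stable under linear combinations are checked on generators; the
  arguments on [TL], [TLlow], [AC] and [orthocompl] all go through this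
  principle. *)
Lemma span_of_ind (A : set V) (Q : V -> Prop) :
  Q 0 -> (forall c x y, A x -> Q y -> Q (c *: x + y)) ->
  forall v, v \in span_of A -> Q v.
Proof.
move=> Q0 QD v vA; have [X XA sX] := span_of_seq A.
have {vA sX} : v \in <<X>>%VS by apply: subvP sX _ vA.
elim: X v XA => [|x X IHX] v XA; first by rewrite span_nil memv0 => /eqP ->.
rewrite span_cons => /memv_addP[_ /vlineP[c ->] [y yX ->]].
apply: QD; first by apply: XA; rewrite mem_head.
by apply: IHX => // z zX; apply: XA; rewrite inE zX orbT.
Qed.

End Span.

(** * Closed strings and Temperley-Lieb pictures *)

Section Scalars.
Context {C : numClosedFieldType} {P : subfactorPlanarAlgebra C}.
Implicit Types (s t : bool) (m p r a b k j : nat) (u v w : ptangle P).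

Lemma scal_lin s c (x y : P 0%N s) : scal (c *: x + y) = c * scal x + scal y.
Proof. by rewrite /scal linearP. Qed.

(** If the empty picture were zero, [scal] and hence all traces would vanish,
  against positivity. *)
Lemma one0_neq0 s : one P 0 s != 0.
Proof.
have [x x0] : exists x : P 0%N s, x != 0.
  have d1 := spa_dim0 P s.
  exists (vpick {: P 0%N s}); rewrite vpick0 -dimv_eq0 d1 //.
apply/eqP => one0; have := spa_pos x0.
by rewrite /Tr /scal -/(one P 0 s) one0 coord0 ltxx.
Qed.

Lemma scal_one s : scal (one P 0 s) = 1.
Proof.
rewrite /scal -/(one P 0 s).
have := @coord_free _ _ _ [tuple one P 0 s] ord0 ord0.
by move->; rewrite //= seq1_free one0_neq0.
Qed.

Lemma zero_boxE s (x : P 0%N s) : x = scal x *: one P 0 s.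
Proof.
have /coord_span : x \in <<[tuple one P 0 s]>>%VS.
  have -> : <<[tuple one P 0 s]>>%VS = fullv.
    apply/eqP; rewrite eqEdim subvf spa_dim0 /= span_seq1 dim_vline.
    by rewrite one0_neq0.
  exact: memvf.
by rewrite big_ord1 /scal.
Qed.

(** [delta] refers to a loop in an unshaded region; sphericality applied to a
  single string gives the shaded one the same value. *)
Lemma loopE s : pa_Z P 0 s [:: (0%N, Cup); (0%N, Cap)] = delta P *: one P 0 s.
Proof.
rewrite [LHS]zero_boxE; congr (_ *: _); case: s => //.
by rewrite /delta; have /= <- := @spa_spherical _ P true [::] isT.
Qed.

Lemma Z_loop k s w1 w2 a m : wf s k w1 m -> wf s m w2 k -> (a <= m)%N ->
  pa_Z P k s (w1 ++ [:: (a, Cup), (a, Cap) & w2])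
  = delta P *: pa_Z P k s (w1 ++ w2).
Proof.
move=> w1P w2P le.
pose t := shade s a.
have wb (x : P 0%N t) : @wf (pa_space P) s k (w1 ++ (a, Box x) :: w2) k.
  by apply: wf_cat w1P _; rewrite /= !addn0 subn0 le eqxx.
have <- : pa_Z P k s (w1 ++ (a, Box (pa_Z P 0 t [:: (0%N, Cup); (0%N, Cap)])) :: w2)
   = pa_Z P k s (w1 ++ [:: (a, Cup), (a, Cap) & w2]).
  by rewrite pa_gluing //= addn0.
by rewrite loopE Z_boxZ // pa_gluing.
Qed.

End Scalars.

Section TemperleyLieb.
Context {C : numClosedFieldType} {P : subfactorPlanarAlgebra C}.
Implicit Types (s t : bool) (m p r a b k j : nat) (u v w : ptangle P).

Lemma mem_TL k s w : boxfree w -> wf s k w k -> pa_Z P k s w \in TL P k s.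
Proof. by move=> bw ww; apply: span_of_mem; exists w. Qed.

Lemma mem_TLlow k s m u v : (m < k)%N -> boxfree (u ++ v) ->
  wf s k u m -> wf s m v k -> pa_Z P k s (u ++ v) \in TLlow P k s.
Proof. by move=> lt bw wu wv; apply: span_of_mem; exists m, u, v. Qed.

Lemma one_TL k s : one P k s \in TL P k s.
Proof. by apply: mem_TL => //=. Qed.

Lemma TLlow_sub k s : (TLlow P k s <= TL P k s)%VS.
Proof.
by apply: span_of_sub => _ [m [u [v [_ b wu wv ->]]]]; apply: mem_TL (wf_cat wu wv).
Qed.

(** Pictures that would be Temperley-Lieb once their labels were expanded. *)
Definition TLlabelled w : bool :=
  all (fun l => if l.2 is @Box _ j t x then x \in TL P j t else true) w.

Lemma TLlabelled_boxfree w : boxfree w -> TLlabelled w.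
Proof. by apply: sub_all => -[a []]. Qed.

(** Expanding the labels one by one by multilinearity and gluing.  The context
  [w1], [w2] and the subspace [W] are arbitrary so that the result also controls
  a cut of the picture along few strings ([TLlow_word]). *)
Lemma TL_subst k s (W : {vspace P k s}) w1 w2 m p :
  wf s k w1 m -> wf s p w2 k ->
  (forall w, boxfree w -> wf s m w p -> pa_Z P k s (w1 ++ w ++ w2) \in W) ->
  forall w, TLlabelled w -> wf s m w p -> pa_Z P k s (w1 ++ w ++ w2) \in W.
Proof.
move=> w1P w2P base w.
(* The labels already expanded are collected in [v]. *)
suff gen v : boxfree v -> TLlabelled w -> wf s m (v ++ w) p ->
    pa_Z P k s (w1 ++ (v ++ w) ++ w2) \in W by exact: (gen [::]).
elim: w v => [|[a g] w IHw] v bv; first by rewrite cats0 => _; apply: base.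
case/andP=> gTL wTL wvw.
have absorb u : boxfree u -> wf s m (v ++ u ++ w) p ->
    pa_Z P k s (w1 ++ (v ++ u ++ w) ++ w2) \in W.
  by rewrite catA => bu; apply: IHw; rewrite ?boxfree_cat ?bv.
case: g gTL wvw => [_|_|j t x xTL] wvw.
- exact: (absorb [:: (a, Cup)]).
- exact: (absorb [:: (a, Cap)]).
have [r vr xr] := wf_catE wvw.
have wb (y : P j t) : @wf (pa_space P) s k ((w1 ++ v) ++ (a, Box y) :: w ++ w2) k.
  by apply: wf_cat (wf_cat w1P vr) _; rewrite -cat_cons; apply: wf_cat w2P.
have -> : w1 ++ (v ++ (a, Box x) :: w) ++ w2
    = (w1 ++ v) ++ (a, Box x) :: w ++ w2 by rewrite -!catA.
have {}xr (y : P j t) : @wf (pa_space P) s r ((a, Box y) :: w) p by [].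
move: x xTL {wvw}; apply: span_of_ind => [|c x y xTL IHy].
  by rewrite Z_box0 // mem0v.
rewrite pa_linear //; apply: rpredD IHy; apply: rpredZ; case: xTL => u [bu wu ->].
rewrite pa_gluing //; have := absorb (shift a u).
rewrite boxfree_shift -!catA; apply=> //; apply: wf_cat vr _.
by have [] := eqv_glue_cons wu (xr (pa_Z P j t u)).
Qed.

End TemperleyLieb.

Section Reduction.
Context {C : numClosedFieldType} {P : subfactorPlanarAlgebra C}.
Implicit Types (s t : bool) (m p r a b k j : nat) (u v w : ptangle P).

Lemma TL_word k s w : TLlabelled w -> wf s k w k -> pa_Z P k s w \in TL P k s.
Proof.
move=> tw ww; rewrite -[w]cats0; apply: (@TL_subst _ _ k s _ [::] [::] k k) => //=.
by move=> w' bw' ww'; rewrite cats0; apply: mem_TL.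
Qed.

Lemma TLlow_word k s m u v : (m < k)%N -> TLlabelled u -> TLlabelled v ->
  wf s k u m -> wf s m v k -> pa_Z P k s (u ++ v) \in TLlow P k s.
Proof.
move=> lt tu tv wu wv; apply: (@TL_subst _ _ k s _ [::] v k m) => //= u' bu' wu'.
rewrite -[v]cats0; apply: (@TL_subst _ _ k s _ u' [::] m k) => //= v' bv' wv'.
by rewrite cats0; apply: mem_TLlow wv' => //; rewrite boxfree_cat bu'.
Qed.

(** A cup directly followed by a cap is a loop, a straight string, or a pair of
  pieces at disjoint positions whose heights can be exchanged. *)
Lemma Z_cup_cap k s (W : {vspace P k s}) w1 w2 a b p :
  wf s k w1 p -> wf s p w2 k -> (a <= p)%N -> (b <= p)%N ->
  pa_Z P k s (w1 ++ w2) \in W ->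
  (forall a' b', @wf (pa_space P) s p [:: (b', Cap); (a', Cup)] p ->
     pa_Z P k s (w1 ++ [:: (b', Cap), (a', Cup) & w2]) \in W) ->
  pa_Z P k s (w1 ++ [:: (a, Cup), (b, Cap) & w2]) \in W.
Proof.
move=> w1P w2P ap bp W12 Wex.
have eqW u v : eqv s p k u v -> pa_Z P k s (w1 ++ u) = pa_Z P k s (w1 ++ v).
  by case=> _ _ /(_ k w1 [::] w1P (eqxx _)); rewrite !cats0.
have [eab|nab] := eqVneq a b; first by rewrite eab (Z_loop w1P w2P) // rpredZ.
have [eb|nb] := eqVneq b a.+1; first by rewrite (eqW _ _ (eqv_zigzag eb _ w2P)) //; lia.
have [ea|na] := eqVneq a b.+1; first by rewrite (eqW _ _ (eqv_zagzig ea _ w2P)) //; lia.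
have wab : @wf (pa_space P) s p [:: (a, Cup), (b, Cap) & w2] k.
  by rewrite /= (_ : p - 0 + 2 - 2 + 0 = p)%N ?w2P; lia.
have [lt|lt] := ltnP a b.
  rewrite (eqW _ _ (@eqv_exch_cons _ _ (b - 2) _ _ _ _ _ _ _ _ _ _ wab)) /=; try lia.
  by apply: Wex; wfs.
have wba : @wf (pa_space P) s p [:: (b, Cap), ((a - 2)%N, Cup) & w2] k.
  by rewrite /= (_ : p - 2 + 0 - 0 + 2 = p)%N ?w2P; lia.
rewrite -(eqW _ _ (@eqv_exch_cons _ _ a _ _ _ _ _ _ _ _ _ _ wba)) /=; try lia.
by apply: Wex; wfs.
Qed.

(** A Temperley-Lieb picture whose top is larger than its bottom may be assumed
  to end with a cup.  Otherwise it ends with a cap; the part below that cap may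
  by induction be assumed to end with a cup, which either merges with the cap,
  giving a shorter picture, or can be moved above it.  The bound on the size of
  [w0] is what lets [TL_split] use this result inside another induction on
  size. *)
Lemma Z_last_cup k s (W : {vspace P k s}) w1 m N p w w2 :
  wf s k w1 m -> wf s p w2 k -> boxfree w -> wf s m w p -> (m < p)%N ->
  (size w <= N)%N ->
  (forall w0 a, boxfree w0 -> (size w0 < N)%N -> wf s m (rcons w0 (a, Cup)) p ->
     pa_Z P k s (w1 ++ w0 ++ (a, Cup) :: w2) \in W) ->
  pa_Z P k s (w1 ++ w ++ w2) \in W.
Proof.
move=> w1P; elim: N p w w2 => [|N IHN] p w w2 w2P.
  by case: w => //= _ /eqP <-; rewrite ltnn.
case/lastP: w => [|w [b g]]; first by move=> _ /eqP <-; rewrite ltnn.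
rewrite -cats1 boxfree_cat => /andP[bw bg] /wf_catE[r wr gr] lt.
rewrite size_cat addn1 ltnS => sw Wcup; rewrite -catA.
case: g bg gr => // _ /=; first by move=> gr; apply: Wcup; rewrite // -cats1 (wf_cat wr).
move=> /andP[le /eqP rp].
have er : r = p.+2 by lia.
rewrite {r}er in wr le rp *.
apply: (IHN p.+2) => //=; first by rewrite subn2 /= addn0 w2P; lia. lia.
move=> w0 a bw0 sw0; rewrite -cats1 => /wf_catE[r w0r /= /andP[ar /eqP er]].
have {er} er : r = p by lia.
rewrite {}er in w0r ar; have w10 := wf_cat w1P w0r.
rewrite catA; apply: (Z_cup_cap w10 w2P) => //; [lia | lia | |].
  rewrite -catA; apply: (IHN p) => //; [lia | move=> w' a' bw' sw' ww'].
  by apply: Wcup ww' => //; lia.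
move=> a' b' wab; rewrite -catA -cat_rcons; apply: Wcup.
- by rewrite -cats1 boxfree_cat bw0.
- by rewrite size_rcons.
- by rewrite -!cats1 -catA; apply: wf_cat w0r wab.
Qed.

(** A diagram has a cut along fewer than [k] strings unless it straightens to
  the identity: if it ends with a cap, the picture below the cap can be made to
  end with a cup by [Z_last_cup], and exchanging the two exposes such a cut. *)
Lemma TL_split k s : (TL P k s <= <[one P k s]> + TLlow P k s)%VS.
Proof.
apply: span_of_sub => _ [w [bw ww ->]].
have [N leN] := ubnP (size w); elim: N => // N IHN in w bw ww leN *.
case/lastP: w => [|w [b g]] in bw ww leN *.
  by rewrite memvE addvSl.
move: bw ww leN; rewrite -cats1 boxfree_cat => /andP[bw bg] /wf_catE[r wr gr].
rewrite size_cat addn1 ltnS => sw.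
case: g bg gr => // _ gr.
  apply: subvP (addvSr _ _) _ _; apply: (mem_TLlow _ _ wr gr); last by rewrite boxfree_cat bw.
  by move: gr => /= /andP[_ /eqP]; lia.
have {r gr wr} [wr le] : wf s k w k.+2 /\ (b <= k)%N.
  move: gr wr => /= /andP[le /eqP er]; have -> : r = k.+2 by lia.
  by split=> //; lia.
have wb : @wf (pa_space P) s k.+2 [:: (b, Cap)] k by wfs.
apply: (@Z_last_cup k s _ [::] k (size w) k.+2 w [:: (b, Cap)]) => //=.
move=> w0 a bw0 sw0; rewrite -cats1 => /wf_catE[r w0r /= /andP[ar /eqP er]].
have {er} er : r = k by lia.
rewrite {}er in w0r ar.
apply: (Z_cup_cap w0r) => //; [exact: eqxx | lia | rewrite cats0; apply: IHN => //; lia |].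
move=> a' b' wab; apply: subvP (addvSr _ _) _ _.
have -> : w0 ++ [:: (b', Cap); (a', Cup)] = (w0 ++ [:: (b', Cap)]) ++ [:: (a', Cup)].
  by rewrite -catA.
move: wab => /= /and3P[b'k a'k _].
apply: (@mem_TLlow _ _ _ _ (k - 2)%N); first by lia.
- by rewrite !boxfree_cat bw0.
- by apply: wf_cat w0r _; wfs.
- by wfs.
Qed.

End Reduction.

(** * Products, partial traces and closures *)

Section PlanarOps.
Context {C : fieldType} {P : planarAlgebra C}.
Implicit Types (s t : bool) (m p r a b k j : nat) (u v w : ptangle P).

Definition partial_trace k s (x : P k.+1 s) : P k s :=
  pa_Z P k s [:: (k, Cup); (0%N, Box x); (k, Cap)].

Definition add_string k s (x : P k s) : P k.+1 s :=
  pa_Z P k.+1 s [:: (0%N, Box x)].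

Lemma Z_glue0 k s w1 w2 u j m : wf s k w1 m -> wf s j u j -> (j <= m)%N ->
  wf s m w2 k ->
  pa_Z P k s (w1 ++ (0%N, Box (pa_Z P j s u)) :: w2) = pa_Z P k s (w1 ++ u ++ w2).
Proof.
move=> w1P wu le w2P; rewrite pa_gluing ?shift0 //; apply: wf_cat w1P _.
by rewrite /= /shade addbF eqxx subnK // w2P le.
Qed.

Lemma mul_Z k s u v : wf s k u k -> wf s k v k ->
  mul (pa_Z P k s u) (pa_Z P k s v) = pa_Z P k s (u ++ v).
Proof.
move=> wu wv; rewrite /mul (@Z_glue0 _ _ [::] _ _ _ k) //=; last first.
  by rewrite /shade addbF eqxx subnK // eqxx leqnn.
by rewrite (@Z_glue0 _ _ _ [::] _ _ k) ?cats0 //= eqxx.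
Qed.

Lemma wf_box k s (x : P k s) : @wf (pa_space P) s k [:: (0%N, Box x)] k.
Proof. by wfs. Qed.

Lemma mul_ZZ k s (x : P k s) v : wf s k v k ->
  mul x (pa_Z P k s v) = pa_Z P k s ((0%N, Box x) :: v).
Proof. by move=> wv; rewrite -{1}(pa_unit x) mul_Z //; exact: wf_box. Qed.

Lemma mul_box k s (x : P k s) u : wf s k u k ->
  mul (pa_Z P k s u) x = pa_Z P k s (u ++ [:: (0%N, Box x)]).
Proof. by move=> wu; rewrite -{1}(pa_unit x) mul_Z //; exact: wf_box. Qed.

Lemma mul_linl k s c (x y z : P k s) :
  mul (c *: x + y) z = c *: mul x z + mul y z.
Proof. by rewrite /mul (@pa_linear _ _ _ _ [::]) //; wfs. Qed.

Lemma mul_linr k s c (x y z : P k s) :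
  mul z (c *: x + y) = c *: mul z x + mul z y.
Proof. by rewrite /mul (@pa_linear _ _ _ _ [:: _]) //; wfs. Qed.

Lemma mul1 k s (x : P k s) : mul (one P k s) x = x.
Proof. by rewrite mul_box ?pa_unit //= eqxx. Qed.

Lemma ptr_Z k s u : wf s k.+1 u k.+1 ->
  partial_trace (pa_Z P k.+1 s u) = pa_Z P k s ((k, Cup) :: u ++ [:: (k, Cap)]).
Proof.
move=> wu; rewrite /partial_trace (@Z_glue0 _ _ [:: _] _ _ _ k.+2) //=; try lia.

Qed.

Lemma add_string_Z k s u : wf s k u k ->
  add_string (pa_Z P k s u) = pa_Z P k.+1 s u.
Proof.
move=> wu; rewrite /add_string (@Z_glue0 _ _ [::] [::] _ _ k.+1) ?cats0 //=.
Qed.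

Lemma ncupsS a k : ncups a k.+1 = ncups a k ++ [:: ((a + k)%N, Cup)] :> ptangle P.
Proof. by rewrite /ncups -addn1 iotaD map_cat. Qed.

Lemma ncapsS a k : ncaps a k.+1 = ((a + k)%N, Cap) :: ncaps a k :> ptangle P.
Proof. by rewrite /ncaps -addn1 iotaD rev_cat. Qed.

Lemma ncups_head a k : ncups a k.+1 = (a, Cup) :: ncups a.+1 k :> ptangle P.
Proof.
rewrite /ncups /= addn0 (iotaDl 1 0) -map_comp; congr (_ :: _).
by apply: eq_map => i /=; rewrite addnA addn1.
Qed.

Lemma ncaps_last a k : ncaps a k.+1 = ncaps a.+1 k ++ [:: (a, Cap)] :> ptangle P.
Proof.
rewrite /ncaps /= (iotaDl 1 0) rev_cons -cats1 map_cat /= addn0 -map_rev -map_comp.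
by congr (_ ++ _); apply: eq_map => i /=; rewrite addnA addn1.
Qed.

Lemma shift_ncups c a k : shift c (ncups a k) = ncups (c + a) k :> ptangle P.
Proof. by rewrite /shift -map_comp; apply: eq_map => i /=; rewrite addnA. Qed.

Lemma shift_ncaps c a k : shift c (ncaps a k) = ncaps (c + a) k :> ptangle P.
Proof. by rewrite /shift -map_comp; apply: eq_map => i /=; rewrite addnA. Qed.

Lemma wf_ncups s m a k p : (a <= m)%N -> p = (m + k.*2)%N ->
  @wf (pa_space P) s m (ncups a k) p.
Proof.
move=> le ->; elim: k => [|k IHk]; first by wfs.
by rewrite ncupsS; apply: wf_cat IHk _; wfs.
Qed.

Lemma wf_ncaps s m a k p : (a <= p)%N -> m = (p + k.*2)%N ->
  @wf (pa_space P) s m (ncaps a k) p.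
Proof.
move=> le ->; elim: k => [|k IHk]; first by wfs.
rewrite ncapsS /= (_ : p + k.+1.*2 - 2 + 0 = p + k.*2)%N ?IHk ?andbT; lia.
Qed.

Lemma wf_closure s k w : wf s k w k ->
  wf s 0 (ncups 0 k ++ w ++ ncaps 0 k) 0.
Proof.
move=> ww; apply: wf_cat (wf_ncups s (leqnn 0) (erefl _)) _.
apply: wf_cat (wf_ncaps s (leqnn 0) (erefl _)).
by have := wf_widen k ww; rewrite add0n -addnn.
Qed.

Lemma Tr_Z k s w : wf s k w k ->
  Tr (pa_Z P k s w) = scal (pa_Z P 0 s (ncups 0 k ++ w ++ ncaps 0 k)).
Proof.
move=> ww; rewrite /Tr (@Z_glue0 _ _ _ _ _ _ k.*2) //.
- exact: wf_ncups.
- by rewrite -addnn leq_addr.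
- exact: wf_ncaps.
Qed.

Lemma Tr_ptr k s (x : P k.+1 s) : Tr (partial_trace x) = Tr x.
Proof.
rewrite /partial_trace Tr_Z; last by wfs.
by rewrite [in RHS]/Tr ncupsS ncapsS -!catA.
Qed.

Lemma ptr_lin k s c (x y : P k.+1 s) :
  partial_trace (c *: x + y) = c *: partial_trace x + partial_trace y.
Proof. by rewrite /partial_trace (@pa_linear _ _ _ _ [:: _]) //; wfs. Qed.

(** The partial trace is a bimodule map: [x] does not meet the string that is
  closed. *)
Lemma ptr_mull k s (x : P k s) (y : P k.+1 s) :
  partial_trace (mul (add_string x) y) = mul x (partial_trace y).
Proof.
rewrite [in RHS]/partial_trace mul_ZZ; last by wfs.
rewrite mul_box ?ptr_Z; try wfs.
apply/eqv_Z/eqv_sym/eqv_exch_cons => /=; rewrite ?/shade; lia.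
Qed.

End PlanarOps.

(** * The trace and the inner product *)

(* [fourier] and [fourier_inv] with a free target sign [t]: for a variable [s] the
   sign [~~ ~~ s] is not convertible to [s], so that composites such as
   [fourier (fourier_inv x)] do not have the type of [x]. *)
Local Notation fou s t k x :=
  (pa_Z _ k t [:: (0%N, Cup); (1%N, @Box _ k s x); (k, Cap)]).
Local Notation ifou s t k x :=
  (pa_Z _ k t [:: (k, Cup); (1%N, @Box _ k s x); (0%N, Cap)]).

Section Sphere.
Context {C : numClosedFieldType} {P : subfactorPlanarAlgebra C}.
Implicit Types (s t : bool) (m p r a b k j : nat) (u v w : ptangle P).

Lemma Tr_lin k s c (x y : P k s) : Tr (c *: x + y) = c * Tr x + Tr y.
Proof.
rewrite /Tr pa_linear ?scal_lin //.
by have := @wf_closure _ P s k [:: (0%N, Box x)] (wf_box x).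
Qed.

Lemma Tr0 k s : Tr (0 : P k s) = 0.
Proof. by have := Tr_lin (-1) (0 : P k s) 0; rewrite scaler0 addr0 mulN1r addNr. Qed.

Lemma TrZ k s c (x : P k s) : Tr (c *: x) = c * Tr x.
Proof. by rewrite -[c *: x]addr0 Tr_lin Tr0 addr0. Qed.

Lemma star0 k s : star (0 : P k s) = 0.
Proof.
have := spa_star_linear (-1) (0 : P k s) 0.
by rewrite scaler0 addr0 rmorphN rmorph1 scaleN1r addNr.
Qed.

Lemma star_inj k s : injective (@star _ P k s).
Proof. exact: can_inj (@spa_starK _ P k s). Qed.

Lemma starD k s (x y : P k s) : star (x + y) = star x + star y.
Proof. by have := spa_star_linear 1 x y; rewrite scale1r rmorph1 scale1r. Qed.

Lemma starZ k s c (x : P k s) : star (c *: x) = c^* *: star x.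
Proof. by rewrite -[c *: x]addr0 spa_star_linear star0 addr0. Qed.

Lemma starN k s (x : P k s) : star (- x) = - star x.
Proof. by rewrite -scaleN1r starZ rmorphN rmorph1 scaleN1r. Qed.

Lemma star_one k s : star (one P k s) = one P k s.
Proof. by rewrite spa_star_Z //=. Qed.

Lemma star_mul k s (x y : P k s) : star (mul x y) = mul (star y) (star x).
Proof. by rewrite spa_star_Z //; wfs. Qed.

Lemma star_ptr k s (x : P k.+1 s) : star (partial_trace x) = partial_trace (star x).
Proof. by rewrite spa_star_Z //; wfs. Qed.

Lemma star_add_string k s (x : P k s) : star (add_string x) = add_string (star x).
Proof. by rewrite spa_star_Z //; wfs. Qed.

Lemma star_E k s i : (i.+1 < k)%N -> star (E P k s i) = E P k s i.
Proof. by move=> ik; rewrite spa_star_Z //; wfs. Qed.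

Lemma star_fou k s t (x : P k s) : t = ~~ s -> (0 < k)%N ->
  star (fou s t k x) = ifou s t k (star x).
Proof. by move=> -> k0; rewrite spa_star_Z //; wfs. Qed.

Lemma star_ifou k s t (x : P k s) : t = ~~ s -> (0 < k)%N ->
  star (ifou s t k x) = fou s t k (star x).
Proof. by move=> -> k0; rewrite spa_star_Z //; wfs. Qed.

Lemma mirror_cat f (u v : ptangle P) : mirror f (u ++ v) = mirror f v ++ mirror f u.
Proof. by rewrite /mirror map_cat rev_cat. Qed.

Lemma mirror_ncups f a k : mirror f (ncups a k : ptangle P) = ncaps a k.
Proof. by rewrite /mirror /ncups /ncaps -map_comp map_rev. Qed.

Lemma mirror_ncaps f a k : mirror f (ncaps a k : ptangle P) = ncups a k.
Proof. by rewrite /mirror /ncups /ncaps map_rev map_rev revK -map_comp. Qed.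

Lemma scal_star s (x : P 0%N s) : scal (star x) = (scal x)^*.
Proof.
rewrite {1}[x]zero_boxE starZ star_one -[_ *: _]addr0 scal_lin scal_one mulr1.
by rewrite /scal linear0 addr0.
Qed.

Lemma Tr_star k s (x : P k s) : Tr (star x) = (Tr x)^*.
Proof.
rewrite {2}/Tr -scal_star spa_star_Z; last exact: (wf_closure (wf_box x)).
by rewrite -[_ :: ncaps 0 k]cat1s !mirror_cat mirror_ncups mirror_ncaps -catA.
Qed.

Lemma inner_lin k s (x : P k s) c y z :
  inner x (c *: y + z) = c * inner x y + inner x z.
Proof. by rewrite /inner mul_linr Tr_lin. Qed.

Lemma inner0 k s (x : P k s) : inner x 0 = 0.
Proof. by have := inner_lin x (-1) 0 0; rewrite scaler0 addr0 mulN1r addNr. Qed.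

Lemma innerZ k s (x : P k s) c y : inner x (c *: y) = c * inner x y.
Proof. by rewrite -[c *: y]addr0 inner_lin inner0 addr0. Qed.

Lemma inner_conj k s (x y : P k s) : inner y x = (inner x y)^*.
Proof. by rewrite /inner -Tr_star star_mul spa_starK. Qed.

Lemma inner_linl k s c (x y z : P k s) :
  inner (c *: x + y) z = c^* * inner x z + inner y z.
Proof.
by rewrite inner_conj inner_lin rmorphD rmorphM /= -!inner_conj.
Qed.

Lemma inner_eq0 k s (x : P k s) : inner x x = 0 -> x = 0.
Proof.
move=> xx; apply/eqP; apply: contraT => /spa_pos.
by rewrite -/(inner x x) xx ltxx.
Qed.

(** The partial trace is adjoint to the addition of a string. *)
Lemma inner_ptr k s (x : P k s) (y : P k.+1 s) :
  inner x (partial_trace y) = inner (add_string x) y.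
Proof. by rewrite /inner -ptr_mull star_add_string Tr_ptr. Qed.

(** * Unitarity of the Fourier transform *)

Lemma wf_fou s t k (x : P k s) : t = ~~ s -> (0 < k)%N ->
   @wf (pa_space P) t k [:: (0%N, Cup); (1%N, Box x); (k, Cap)] k.
Proof. by move=> -> k0; wfs. Qed.

Lemma wf_ifou s t k (x : P k s) : t = ~~ s -> (0 < k)%N ->
   @wf (pa_space P) t k [:: (k, Cup); (1%N, Box x); (0%N, Cap)] k.
Proof. by move=> -> k0; wfs. Qed.

(** The two closures compared in [Tr_fou] contain these zigzags: in the first
  the outermost string turns back on the left of [x], in the second the
  innermost one turns back on its right. *)
Lemma fou_left_turn k s t (x : P k.+1 t) top : t = ~~ s ->
  wf s k.+1.*2 top 0 ->
  eqv s k.*2 0 [:: (0%N, Cup), (1%N, Box x), (1%N, Cup), (0%N, Cap) & top]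
               [:: (0%N, Cup), (1%N, Box x) & top].
Proof.
move=> et wt; have wtm m : m = k.+1.*2 -> wf s m top 0 by move->.
apply: eqv_head; first by wfs.
apply: eqv_head; first by wfs.
apply: eqv_zagzig => //; last apply: wtm; rewrite /=; lia.
Qed.

Lemma fou_right_turn k s t (x : P k.+1 t) top : t = ~~ s ->
  wf s k.+1.*2 top 0 ->
  eqv s k.*2 0 [:: (k, Cup), (0%N, Cup), (1%N, Box x), (k.+1, Cap) & top]
               [:: (0%N, Cup), (1%N, Box x) & top].
Proof.
move=> et wt; have wtm m : m = k.+1.*2 -> wf s m top 0 by move->.
have wexch : @wf (pa_space P) s k.*2
    [:: (0%N, Cup), (k.+2, Cup), (1%N, Box x), (k.+1, Cap) & top] 0.
  by rewrite /= wtm /shade; lia.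
apply: eqv_trans.
  by apply: eqv_sym; apply: eqv_exch_cons wexch => /=; lia.
apply: eqv_head; first by wfs.
have wexch' : @wf (pa_space P) s (k.*2 - 0 + 2)
    [:: (1%N, Box x), (k.+2, Cup), (k.+1, Cap) & top] 0.
  by rewrite /= wtm /shade; lia.
apply: eqv_trans.
  by apply: eqv_sym; apply: eqv_exch_cons wexch' => /=; lia.
apply: eqv_head; first by wfs.
apply: eqv_zagzig => //; last apply: wtm; rewrite /=; lia.
Qed.

(** The two closed pictures differ by moving the outermost string of the
  closure from the right to the left of everything else, which sphericality
  allows; the rest is planar. *)
Lemma Tr_fou k s t (x : P k t) (y : P k s) : t = ~~ s -> (0 < k)%N ->
  Tr (mul x (fou s t k y)) = Tr (mul (fou t s k x) y).
Proof.
case: k => // k in x y *; move=> et _; have es : s = ~~ t by rewrite et negbK.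
(* Cut open along the outermost string, the first closure is [w]. *)
have w1 : @wf (pa_space P) t k.+1
    [:: (0%N, Box x); (0%N, Cup); (1%N, Box y); (k.+1, Cap)] k.+1.
  by wfs.
have w2 : @wf (pa_space P) s k.+1
    [:: (0%N, Cup); (1%N, Box x); (k.+1, Cap); (0%N, Box y)] k.+1.
  by wfs.
rewrite mul_ZZ; last exact: wf_fou.
rewrite mul_box; last by apply: wf_fou.
rewrite (Tr_Z w1) (Tr_Z w2).
pose w : ptangle P := ncups 1 k ++
  [:: (0%N, Box x); (0%N, Cup); (1%N, Box y); (k.+1, Cap)] ++ ncaps 1 k.
have -> : ncups 0 k.+1 ++ [:: (0%N, Box x); (0%N, Cup); (1%N, Box y);
     (k.+1, Cap)] ++ ncaps 0 k.+1 = (0%N, Cup) :: w ++ [:: (0%N, Cap)].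
  by rewrite ncups_head ncaps_last /w /= -!catA.
rewrite spa_spherical; last first.
  apply: wf_cat (wf_ncups _ (leqnn 1) (erefl _)) _.
  apply: wf_cat (wf_ncaps _ (leqnn 1) (erefl _)).
  have := wf_widen k w1; rewrite (_ : k.+1 + k = 1 + k.*2)%N //; lia.
rewrite -es; congr scal; apply: eqv_Z.
pose top : ptangle P := [:: (0%N, Box y); (k, Cap)] ++ ncaps 0 k.
have wtop : wf s k.+1.*2 top 0.
  rewrite /top /= (_ : k.+1.*2 - k.+1 + k.+1 - 2 + 0 = k.*2)%N; last by lia.
  rewrite wf_ncaps // /shade; lia.
have wcups m : wf s m (ncups 0 k : ptangle P) (m + k.*2) by apply: wf_ncups.
(* The cup of the outermost string slides up past the other cups, and its cap
   slides down until it meets the cup under [y]. *)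
have lower : @eqv _ P s 0 k.+1.*2 ((0%N, Cup) :: ncups 2 k)
    (ncups 0 k ++ [:: (0%N, Cup)]).
  have := @eqv_slide _ P s 0 k.+1.*2 0 Cup (ncups 0 k).
  rewrite !shift_ncups; apply.
  by rewrite /= wf_ncups //; lia.
have upper : @eqv _ P s k.+1.*2.+2 0
    ([:: (2%N, Box y); (k.+2, Cap)] ++ ncaps 2 k ++ [:: (0%N, Cap)])
    ((0%N, Cap) :: top).
  have wt : wf s k.+1.*2.+2 ((0%N, Cap) :: shift (0 + @nout (pa_space P) Cap) top) 0.
    by rewrite shift0 /= subn2 addn0.
  have := eqv_slide wt; rewrite shift0 [X in eqv _ _ _ _ (X ++ _)]shift_cat.
  by rewrite shift_ncaps -catA => /eqv_sym.
have -> : (0%N, Cup) :: shift 1 w ++ [:: (0%N, Cap)] =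
    ((0%N, Cup) :: ncups 2 k) ++ [:: (1%N, Box x); (1%N, Cup)] ++
    [:: (2%N, Box y); (k.+2, Cap)] ++ ncaps 2 k ++ [:: (0%N, Cap)] :> ptangle P.
  by rewrite /w !shift_cat shift_ncups shift_ncaps /= -!catA.
have xbox : @eqv _ P s k.+1.*2 k.+1.*2 [:: (1%N, Box x)] [:: (1%N, Box x)].
  by apply: eqv_refl; wfs.
have cup1 : @eqv _ P s k.+1.*2 k.+1.*2.+2 [:: (1%N, Cup)] [:: (1%N, Cup)].
  by apply: eqv_refl; wfs.
apply: eqv_trans.
  apply: eqv_cat lower (eqv_cat (eqv_cat xbox cup1) upper).
rewrite ncupsS ncapsS -!catA /=.
rewrite !add0n.
apply: (@eqv_trans _ _ (ncups 0 k ++ [:: (0%N, Cup), (1%N, Box x) & top])).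
  exact: eqv_cat (eqv_refl (wcups 0%N)) (fou_left_turn _ et wtop).
exact: eqv_sym (eqv_cat (eqv_refl (wcups 0%N)) (fou_right_turn _ et wtop)).
Qed.

Lemma inner_fou k s t (x : P k t) (y : P k s) : t = ~~ s -> (0 < k)%N ->
  inner x (fou s t k y) = inner (ifou t s k x) y.
Proof.
move=> et k0; rewrite /inner Tr_fou // star_ifou // et negbK //.
Qed.

Lemma inner_ifou k s t (x : P k t) (y : P k s) : t = ~~ s -> (0 < k)%N ->
  inner x (ifou s t k y) = inner (fou t s k x) y.
Proof.
by move=> et k0; rewrite inner_conj -inner_fou -?inner_conj // et negbK.
Qed.

End Sphere.

(** * Elements orthogonal to Temperley-Lieb cannot be capped *)

Section Uncappable.
Context {C : numClosedFieldType} {P : subfactorPlanarAlgebra C}.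
Implicit Types (s t : bool) (m p r a b k j n : nat) (u v w : ptangle P).

Lemma ifouK k s t (x : P k s) : t = ~~ s -> (0 < k)%N ->
  fou t s k (ifou s t k x) = x.
Proof.
move=> -> k0; case: s x => x; have := fourier_invK x k0;
  by rewrite (eq_irrelevance (negbK _) erefl).
Qed.

Lemma fouK k s t (x : P k s) : t = ~~ s -> (0 < k)%N ->
  ifou t s k (fou s t k x) = x.
Proof.
move=> et k0; apply: star_inj; rewrite star_ifou // ?star_fou ?ifouK //.
by rewrite et negbK.
Qed.

Lemma TL_fou k s t (x : P k s) : t = ~~ s -> (0 < k)%N -> x \in TL P k s ->
  fou s t k x \in TL P k t.
Proof.
by move=> et k0 xTL; apply: TL_word; [rewrite /TLlabelled /= xTL | exact: wf_fou].
Qed.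

Lemma TL_ifou k s t (x : P k s) : t = ~~ s -> (0 < k)%N -> x \in TL P k s ->
  ifou s t k x \in TL P k t.
Proof.
by move=> et k0 xTL; apply: TL_word; [rewrite /TLlabelled /= xTL | exact: wf_ifou].
Qed.

Lemma boxfree_mirror f w : boxfree (mirror f w) = boxfree w.
Proof.
by rewrite /boxfree /mirror all_rev all_map; apply: eq_all => -[a []].
Qed.

Lemma wf_mirror f s m w p : wf s m w p -> wf s p (mirror f w) m.
Proof.
elim: w m => [|[a g] w IHw] m /=; first by move/eqP->; exact: eqxx.
case/and3P=> le sg /IHw ww; rewrite /mirror map_cons rev_cons -cats1.
by apply: wf_cat ww _; case: g le sg => [||k t x] /= le sg; rewrite ?sg /=; lia.
Qed.

Lemma TLlow_star k s (x : P k s) : x \in TLlow P k s -> star x \in TLlow P k s.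
Proof.
move: x; apply: span_of_ind => [|c y z [m [u [v [lt bw wu wv ->]]]] Qz].
  by rewrite star0 mem0v.
rewrite spa_star_linear spa_star_Z ?mirror_cat; last exact: wf_cat wu wv.
apply: rpredD Qz; apply: rpredZ; apply: (mem_TLlow lt); try exact: wf_mirror.
by rewrite -mirror_cat boxfree_mirror.
Qed.

(** By induction on the size a box in the image of the annular maps has a
  Temperley-Lieb label, so the picture expands to diagrams.  The hypothesis
  concerns unshaded boxes; the Fourier transform transports the result to shaded
  ones, and spaces of size zero are one dimensional. *)
Lemma annular0_TL n : (forall k, (0 < k < n)%N -> annular_mult P k = 0%N) ->
  forall k s, (k < n)%N -> forall x : P k s, x \in TL P k s.
Proof.
move=> ann; suff pos k : (k < n)%N -> forall x : P k true, x \in TL P k true.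
  case=> [|k] [] ltk x; try exact: pos.
    by rewrite [x]zero_boxE rpredZ ?one_TL.
  by rewrite -(@ifouK _ _ true x) // TL_fou // pos.
elim/ltn_ind: k => -[_ _ x|k IHk ltk x]; first by rewrite [x]zero_boxE rpredZ ?one_TL.
have : x \in AC P k.+1.
  have -> : AC P k.+1 = fullv; last exact: memvf.
  by apply/eqP; rewrite eqEdim subvf -subn_eq0 -/(annular_mult _ _) ann.
move: x; apply: span_of_ind => [|c y z Ay Qz]; first exact: mem0v.
apply: rpredD Qz; apply: rpredZ; case: Ay => j [x [a [u [v [ltj buv wx ->]]]]].
apply: TL_word wx; move: buv; rewrite boxfree_cat => /andP[bu bv].
rewrite /TLlabelled all_cat /= IHk ?(ltn_trans ltj ltk) //.
by rewrite -!/(TLlabelled _) !TLlabelled_boxfree.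
Qed.

Definition perpTL k s (x : P k s) := forall y, y \in TL P k s -> inner y x = 0.

Lemma perp_fou k s t (x : P k s) : t = ~~ s -> (0 < k)%N -> perpTL x ->
  perpTL (fou s t k x).
Proof.
move=> et k0 px y yTL; rewrite inner_fou //; apply: px; apply: TL_ifou => //.
by rewrite et negbK.
Qed.

Lemma perp_ifou k s t (x : P k s) : t = ~~ s -> (0 < k)%N -> perpTL x ->
  perpTL (ifou s t k x).
Proof.
move=> et k0 px y yTL; rewrite inner_ifou //; apply: px; apply: TL_fou => //.
by rewrite et negbK.
Qed.

(** By adjointness the squared norm of the partial trace is the inner product of
  [x] with a Temperley-Lieb element. *)
Lemma perp_ptr n s (x : P n.+1 s) : (forall y : P n s, y \in TL P n s) ->
  perpTL x -> partial_trace x = 0.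
Proof.
move=> full px; apply: inner_eq0; rewrite inner_ptr; apply: px.
by apply: TL_word; [rewrite /TLlabelled /= full | wfs].
Qed.

Lemma Z_ptr0 n s (x : P n.+1 s) k t w1 w2 a m : partial_trace x = 0 ->
  wf t k w1 m -> wf t m w2 k -> s = shade t a -> (a + n <= m)%N ->
  pa_Z P k t (w1 ++ [:: ((a + n)%N, Cup), (a, Box x), ((a + n)%N, Cap) & w2]) = 0.
Proof.
move=> x0 w1P w2P es le.
have wb (y : P n s) : @wf (pa_space P) t k (w1 ++ (a, Box y) :: w2) k.
  by apply: wf_cat w1P _; rewrite /= es eqxx subnK ?le //; lia.
transitivity (pa_Z P k t (w1 ++ (a, Box (partial_trace x)) :: w2)).
  by rewrite /partial_trace pa_gluing /= ?addn0 //; wfs.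
by rewrite x0 Z_box0.
Qed.

(** Each rotation by one click moves a cup at the bottom one step to the right,
  until it becomes the cap of the partial trace. *)
Lemma perp_cup0 n s (x : P n.+1 s) (i : nat) k t w1 w2 a m :
  (forall (t' : bool) (y : P n t'), y \in TL P n t') -> perpTL x -> (i < n)%N ->
  wf t k w1 m -> wf t m.+2 ((a, Box x) :: w2) k -> (a + i <= m)%N ->
  pa_Z P k t (w1 ++ [:: ((a + i)%N, Cup), (a, Box x) & w2]) = 0.
Proof.
move=> full; have [d] := ubnP (n - i).
elim: d => // d IHd in s x i w1 w2 a m *; rewrite ltnS => dn px lt w1P w2P ai.
have [z pz ex] : exists2 z : P n.+1 (~~ s), perpTL z & fou (~~ s) s n.+1 z = x.
  exists (ifou s (~~ s) n.+1 x); first exact: perp_ifou.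
  by apply: ifouK.
rewrite -ex in w2P *.
have wz : @wf (pa_space P) s n.+1 [:: (0%N, Cup); (1%N, Box z); (n.+1, Cap)] n.+1.
  by wfs.
rewrite -cat_rcons pa_gluing //; last first.
  by rewrite -cats1; apply: wf_cat w2P; apply: wf_cat w1P _; wfs.
rewrite cat_rcons /= addn0 addn1.
have wx : @wf (pa_space P) t m [:: (a, Cup), ((a + i).+2, Cup), (a.+1, Box z),
   ((a + n.+1)%N, Cap) & w2] k.
  move: w2P => /= /and3P[a2 /eqP es]; rewrite (_ : m.+2 - n.+1 + n.+1 = m.+2)%N //; last by lia.
  rewrite (_ : m - 0 + 2 - 0 + 2 - n.+1 + n.+1 - 2 + 0 = m.+2)%N; last by lia.
  by move->; rewrite /shade in es *; lia.
have {}ex : eqv t m k [:: (a, Cup), ((a + i).+2, Cup), (a.+1, Box z),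
   ((a + n.+1)%N, Cap) & w2]
  [:: ((a + i)%N, Cup), (a, Cup), (a.+1, Box z), ((a + n.+1)%N, Cap) & w2].
  by apply: eqv_exch_cons wx => /=; lia.
case: ex => _ _ /(_ k w1 [::] w1P (eqxx _)); rewrite !cats0 => <-.
rewrite -cat_rcons.
have w1P' : wf t k (rcons w1 (a, Cup)) m.+2.
  by rewrite -cats1; apply: wf_cat w1P _; wfs.
have {w2P} [le es w2P] : [/\ (a + n.+1 <= m.+2)%N, s = shade t a & wf t m.+2 w2 k].
  by move: w2P => /= /and3P[le /eqP es]; rewrite subnK //; lia.
have [ltS|geS] := ltnP i.+1 n.
  rewrite (_ : (a + i).+2 = a.+1 + i.+1)%N; last by lia.
  apply: IHd w1P' _ _ => //; [by lia | | by lia].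
  rewrite /= (_ : m.+4 - n.+1 + n.+1 - 2 + 0 = m.+2)%N; last by lia.
  by rewrite w2P es /shade; lia.
rewrite (_ : (a + i).+2 = a.+1 + n)%N; last by lia.
rewrite (_ : a + n.+1 = a.+1 + n)%N; last by lia.
by apply: Z_ptr0 w1P' w2P _ _; [exact: perp_ptr | rewrite es /shade; lia | lia].
Qed.

(** It is enough that each single cup kills the picture [w2] placed above it, in
  any context: a diagram with a narrow cut can be made to end with a cup. *)
Lemma TLlow_mul0 k s (w2 : ptangle P) : wf s k w2 k ->
  (forall w1 m a, wf s k w1 m -> m.+2 = k -> (a <= m)%N ->
     pa_Z P k s (w1 ++ (a, Cup) :: w2) = 0) ->
  forall x, x \in TLlow P k s -> mul x (pa_Z P k s w2) = 0.
Proof.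
move=> w2P kill; apply: span_of_ind => [|c x y Ax Qy].
  by have := mul_linl (-1) 0 0 (pa_Z P k s w2); rewrite scaler0 addr0 scaleN1r addNr.
rewrite mul_linl Qy addr0; case: Ax => m [u [v [lt buv wu wv ->]]].
rewrite mul_Z //; last exact: wf_cat wu wv.
suff : pa_Z P k s (u ++ v ++ w2) \in 0%VS.
  by rewrite memv0 -catA => /eqP ->; rewrite scaler0.
apply: (Z_last_cup wu w2P _ wv lt (leqnn _)).
  by move: buv; rewrite boxfree_cat => /andP[].
move=> w0 a bw0 _; rewrite -cats1 => /wf_catE[r w0r /= /andP[ar /eqP er]].
by rewrite catA (kill _ r) ?mem0v //; [exact: wf_cat wu w0r | lia | lia].
Qed.

Lemma TLlow_perp k s x : (forall y, y \in TLlow P k s -> mul y x = 0) ->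
  forall y, y \in TLlow P k s -> inner y x = 0.
Proof.
by move=> kill y yl; rewrite /inner kill ?Tr0 //; exact: TLlow_star.
Qed.

(** A cup under [circ x y] caps [x] directly, except at the last position, where
  it joins the last bottom point of [x] to the string leading to its last top
  point. *)
Lemma circ_TLlow n s (x y : P n.+1 s) :
  (forall (t' : bool) (y : P n t'), y \in TL P n t') -> perpTL x ->
  forall z, z \in TLlow P n.+2 s -> mul z (circ x y) = 0.
Proof.
move=> full px; apply: TLlow_mul0 => [|w1 m a w1P [em] am]; first by wfs.
subst m.
have [lt|ge] := ltnP a n.
  by apply: (@perp_cup0 n s x a _ _ _ _ 0%N _ full px lt w1P) => //; wfs.
have -> : a = n by lia.
apply: (@Z_ptr0 _ _ x _ _ _ _ 0%N _ (perp_ptr (full s) px) w1P) => //; wfs.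
Qed.

Lemma ptr_circ n s (x y : P n.+1 s) : partial_trace (circ x y) = mul x y.
Proof.
rewrite /circ ptr_Z; last by wfs.
apply: eqv_Z => /=.
have w1 : @wf (pa_space P) s n.+1 [:: (0%N, Box x); (n.+1, Cup); (n, Cap);
  (n, Cup); (0%N, Box y); (n.+1, Cap)] n.+1 by wfs.
apply: eqv_trans; first by apply: eqv_sym; apply: eqv_exch_cons w1 => /=; lia.
apply: eqv_head; first by wfs.
apply: eqv_trans; first by apply: eqv_zagzig => //=; [lia | wfs].
apply: eqv_trans.
  apply: eqv_head; first by wfs.
  by apply: (@eqv_exch_cons _ _ n.+1) => //=; wfs.
by apply: eqv_zigzag => //=; wfs.
Qed.

Lemma Tr_circ n s (x y : P n.+1 s) : Tr (circ x y) = Tr (mul x y).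
Proof. by rewrite -Tr_ptr ptr_circ. Qed.

End Uncappable.

(** * Jones-Wenzl projections *)

Lemma qint_rec (C : fieldType) (q : C) m : q != 0 ->
  qint q m.+2 = (q + q^-1) * qint q m.+1 - qint q m.
Proof.
move=> q0; rewrite /qint; case: eqVneq => [eq|_].
  have qq : q * q = 1 by rewrite {2}eq divff.
  rewrite -eq; case: m => [|m] /=; first by rewrite mulr0n subr0 expr0 mulr1 expr1 mulr2n.
  rewrite !exprS mulrA qq mul1r; set x := q ^+ m.
  have -> : (q + q) * (q * x *+ m.+2) = x *+ m.+2 + x *+ m.+2.
    by rewrite mulrDl mulrnAr mulrA qq mul1r.
  by apply/eqP; rewrite eq_sym subr_eq -!mulrnDr; apply/eqP; congr (_ *+ _); lia.
rewrite [RHS]addrC mulrA -mulNr -mulrDl; congr (_ / _).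
rewrite -!exprVn !exprS; have e : q * q^-1 = 1 by rewrite divff.
set x := q ^+ m; set y := q^-1 ^+ m; set r := q^-1 in e *.
have -> : (q + r) * (q * x - r * y) =
  q * (q * x) - r * (r * y) + (q * r) * x - (q * r) * y by ring.
by rewrite e; ring.
Qed.

Section JonesWenzl.
Context {C : numClosedFieldType} {P : subfactorPlanarAlgebra C}.
Implicit Types (s t : bool) (m r a b k j n : nat) (u v w : ptangle P).

Lemma add_string_lin k s c (x y : P k s) :
  add_string (c *: x + y) = c *: add_string x + add_string y.
Proof. by rewrite /add_string (@pa_linear _ _ _ _ [::]) //; wfs. Qed.

Lemma add_string_one k s : add_string (one P k s) = one P k.+1 s.
Proof. by rewrite add_string_Z //= eqxx. Qed.

Lemma add_string_low k s (x : P k s) :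
  x \in TLlow P k s -> add_string x \in TLlow P k.+1 s.
Proof.
move: x; apply: span_of_ind => [|c x y [m [u [v [lt buv wu wv ->]]]] Qy].
  have := add_string_lin (-1) (0 : P k s) 0.
  by rewrite scaler0 addr0 scaleN1r addNr => ->; exact: mem0v.
rewrite add_string_lin add_string_Z; last exact: wf_cat wu wv.
apply: rpredD Qy; apply: rpredZ.
by apply: (@mem_TLlow _ _ k.+1 s m.+1) => //;
  [have := wf_widen 1 wu | have := wf_widen 1 wv]; rewrite !addn1.
Qed.

Lemma mul0 k s (x : P k s) : mul 0 x = 0.
Proof. by have := mul_linl (-1) 0 0 x; rewrite scaler0 addr0 scaleN1r addNr. Qed.

Lemma ptr_add_string k s (x : P k s) : partial_trace (add_string x) = delta P *: x.
Proof.
rewrite /add_string ptr_Z; last by wfs.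
transitivity (delta P *: pa_Z P k s ([:: (0%N, Box x)] ++ [::])).
  2: by rewrite pa_unit.
rewrite -(Z_loop (wf_box x) (eqxx k : wf s k [::] k) (leqnn k)).
apply/eqv_Z/eqv_sym/eqv_exch_cons => /=; rewrite ?/shade; lia.
Qed.

(** Being killed by all of [TLlow] makes idempotence automatic ([jw_idem]) and,
  with self-adjointness, yields both the left and the right annihilation
  conditions.  Equivalence with [is_jones_wenzl] is [jw_jones_wenzl] and
  [is_jones_wenzl_jw]. *)
Definition jw k s (p : P k s) : Prop :=
  [/\ star p = p, p - one P k s \in TLlow P k s
    & forall x, x \in TLlow P k s -> mul x p = 0].

Lemma E_low k s i : (i.+1 < k)%N -> E P k s i \in TLlow P k s.
Proof.
by move=> ik; apply: (@mem_TLlow _ _ _ _ (k - 2) [:: (i, Cap)] [:: (i, Cup)]) => //; wfs.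
Qed.

Lemma jw_TL k s (p : P k s) : jw p -> p \in TL P k s.
Proof.
case=> _ low _; rewrite -[p](subrK (one P k s)) rpredD ?one_TL //.
exact: subvP (TLlow_sub _ _) _ low.
Qed.

Lemma jw_mull k s (p x : P k s) : jw p ->
  (forall y, y \in TLlow P k s -> mul y x = 0) -> mul p x = x.
Proof.
case=> _ low _ kill; rewrite -[p](subrK (one P k s)) -[p - _]scale1r.
by rewrite mul_linl kill // scaler0 add0r mul1.
Qed.

Lemma jw_idem k s (p : P k s) : jw p -> mul p p = p.
Proof. by move=> jp; apply: jw_mull => //; case: jp. Qed.

(** [p' p = p] and [p p' = p'], and these products are adjoint. *)
Lemma jw_unique k s (p p' : P k s) : jw p -> jw p' -> p = p'.
Proof.
move=> jp jp'; have [sp _ kp] := jp; have [sp' _ kp'] := jp'.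
by rewrite -sp -(jw_mull jp' kp) star_mul sp sp' jw_mull.
Qed.

Lemma jw_jones_wenzl k s (p : P k s) : jw p -> is_jones_wenzl p.
Proof.
move=> jp; have [sp low kill] := jp; split=> //; first exact: jw_TL.
  exact: jw_idem.
move=> i ik; split; first exact: kill (E_low _ ik).
by rewrite -{1}sp -star_E // -star_mul kill ?star0 // E_low.
Qed.

Lemma Tr_jw_gt0 k s (p : P k s) : jw p -> p != 0 -> 0 < Tr p.
Proof. by move=> jp /spa_pos; case: (jp) => -> _ _; rewrite jw_idem. Qed.

Lemma jw_neq0 k s (p : P k s) : jw p -> one P k s \notin TLlow P k s -> p != 0.
Proof.
by case=> _ low _; apply: contra => /eqP p0; rewrite p0 sub0r rpredN in low.
Qed.

Lemma jw_one0 s : jw (one P 0 s).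
Proof.
split; [exact: star_one | by rewrite subrr mem0v | move=> x].
suff -> : TLlow P 0 s = 0%VS by rewrite memv0 => /eqP ->; rewrite mul0.
apply/eqP; rewrite -subv0; apply: span_of_sub => z [m [u [v [lt]]]].
by rewrite ltn0 in lt.
Qed.

(** Parity: the number of strings keeps its parity along a picture, so one string
  cannot be cut along zero strings. *)
Lemma TLlow1 s : TLlow P 1 s = 0%VS.
Proof.
apply/eqP; rewrite -subv0; apply: span_of_sub => z [m [u [v [lt _ wu _ _]]]].
have : odd 1 = odd m; last by case: m lt {wu}.
elim: u 1%N wu {lt} => [|[a g] u IHu] r /=; first by move/eqP->.
case/and3P=> le _ /IHu <-.
have := odd_nin g; lia.
Qed.

Lemma jw_one1 s : jw (one P 1 s).
Proof.
split; [exact: star_one | by rewrite subrr mem0v | move=> x].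
by rewrite TLlow1 memv0 => /eqP ->; rewrite mul0.
Qed.

Lemma one_low_mono s k l : (k <= l)%N -> one P k s \in TLlow P k s ->
  one P l s \in TLlow P l s.
Proof.
move=> /subnK <-; elim: (l - k)%N => // d IHd /IHd.
by rewrite -(add_string_one (d + k)); exact: add_string_low.
Qed.

(** [delta] is the trace of the identity on one string, a positive number if that
  identity is nonzero. *)
Lemma delta_neq0 s : one P 1 s \notin TLlow P 1 s -> delta P != 0.
Proof.
move=> /(jw_neq0 (jw_one1 s)) /(Tr_jw_gt0 (jw_one1 s)).
rewrite -Tr_ptr -add_string_one ptr_add_string TrZ => lt.
by apply: contraTneq lt => ->; rewrite mul0r ltxx.
Qed.

(* Comparison with [is_jones_wenzl] and the recursion need to divide by the
   value of a loop. *)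
Section Loop.
Context (delta0 : delta P != 0).

(** A cup alone, rather than [E], kills [x]: insert a loop on the cup at the cost
  of a factor [delta]; this creates an [E] under [x]. *)
Lemma Z_cup_E k s (x : P k s) i l w1 w2 m : mul (E P k s i) x = 0 ->
  (i.+1 < k)%N -> wf s l w1 m -> wf s m.+2 ((0%N, Box x) :: w2) l -> (i <= m)%N ->
  pa_Z P l s (w1 ++ [:: (i, Cup), (0%N, Box x) & w2]) = 0.
Proof.
move=> Ex ik w1P w2P im.
have w1P' : wf s l (w1 ++ [:: (i, Cup)]) m.+2 by apply: wf_cat w1P _; wfs.
have cw2 : @wf (pa_space P) s m [:: (i, Cup), (0%N, Box x) & w2] l.
  by apply: (@wf_cat _ s m [:: (i, Cup)]) w2P; wfs.
apply: (scalerI delta0); rewrite scaler0 -(Z_loop w1P cw2 im).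
have [le w2P'] : (k <= m.+2)%N /\ wf s m.+2 w2 l.
  by move: w2P => /= /and3P[le _]; rewrite subnK.
transitivity (pa_Z P l s ((w1 ++ [:: (i, Cup)]) ++ (0%N, Box (mul (E P k s i) x)) :: w2)).
  rewrite mul_box; last by wfs.
  by rewrite (Z_glue0 w1P') -?catA //; wfs.
by rewrite Ex Z_box0 //; apply: wf_cat w1P' _; apply: (@wf_label _ _ _ _ _ [::] _ _ _ _ x).
Qed.

Lemma jw_cup0 k s (p : P k s) a l w1 w2 m : jw p -> (a.+1 < k)%N -> wf s l w1 m ->
  wf s m.+2 ((0%N, Box p) :: w2) l -> (a <= m)%N ->
  pa_Z P l s (w1 ++ [:: (a, Cup), (0%N, Box p) & w2]) = 0.
Proof. by case=> _ _ kill ak; apply: Z_cup_E => //; apply: kill; apply: E_low. Qed.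

Lemma is_jones_wenzl_jw k s (p : P k s) : is_jones_wenzl p -> jw p.
Proof.
case=> pTL pp sp Ep low; split=> // x xlow; rewrite -(pa_unit p).
apply: TLlow_mul0 xlow => [|w1 m a w1P em am]; first exact: wf_box.
apply: (Z_cup_E _ _ w1P) => //; first by apply: (Ep a _).1; lia.
  by lia.
by rewrite em; apply: wf_box.
Qed.

Lemma jones_wenzlE k s (p : P k s) : jw p -> jones_wenzl P k s = p.
Proof.
move=> jp; rewrite /jones_wenzl; case: xgetP => [p' _ jp'|none].
  by apply: jw_unique jp; apply: is_jones_wenzl_jw.
by case: (none p); apply: jw_jones_wenzl.
Qed.

(** Wenzl's recursion formula: [circ p p] is the product of [E], at the last two
  strings, with [p] on both sides, each [p] having one more string added. *)
Definition wenzl k s c (p : P k.+1 s) : P k.+2 s :=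
  add_string p - c^-1 *: circ p p.

Lemma jw_add_stringK k s (p : P k s) (p' : P k.+1 s) : jw p -> jw p' ->
  mul (add_string p) p' = p'.
Proof.
case=> _ low _ [_ _ kill]; rewrite -[p](subrK (one P k s)) -[p - _]scale1r.
rewrite add_string_lin mul_linl add_string_one mul1 kill ?scaler0 ?add0r //.
exact: add_string_low.
Qed.

Lemma circ_low k s (x y : P k.+1 s) : x \in TL P k.+1 s -> y \in TL P k.+1 s ->
  circ x y \in TLlow P k.+2 s.
Proof.
move=> xTL yTL; apply: (@TLlow_word _ _ _ _ k [:: _; _] [:: _; _]) => //;
  by [rewrite /TLlabelled /= ?xTL ?yTL | wfs].
Qed.

(** Cups away from the last two strings are killed by [p'].  On the last two, the
  cup closes a partial trace of the lower [p'] in the correction term, which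
  gives [c] times the first term. *)
Lemma wenzl_jw k s c (p : P k s) (p' : P k.+1 s) :
  jw p -> jw p' -> partial_trace p' = c *: p -> c != 0 -> c^* = c -> jw (wenzl c p').
Proof.
move=> jp jp' cp c0 cR; have [sp' low' kill'] := jp'; split.
- have cV : (c^-1)^* = c^-1 by rewrite fmorphV /= cR.
  rewrite /wenzl starD starN starZ star_add_string sp' cV.
  by congr (_ - _ *: _); rewrite spa_star_Z /mirror /= ?sp' //; wfs.
- have -> : wenzl c p' - one P k.+2 s =
    add_string (p' - one P k.+1 s) - c^-1 *: circ p' p'.
    rewrite -scaleN1r addrC -[- one P k.+1 s]scaleN1r [p' + _]addrC.
    by rewrite add_string_lin add_string_one addrA.
  by rewrite rpredB ?rpredZ ?add_string_low ?circ_low ?jw_TL.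
move=> x xlow; rewrite -(pa_unit (wenzl c p')).
apply: TLlow_mul0 xlow => [|w1 m a w1P [em] am]; first exact: wf_box.
subst m; have w1P' : wf s k.+2 (rcons w1 (a, Cup)) k.+2.
  by rewrite -cats1; apply: wf_cat w1P _; wfs.
rewrite -cat_rcons /wenzl addrC -scaleNr pa_linear; last exact: wf_cat w1P' (wf_box _).
rewrite !(Z_glue0 w1P') ?cats0 //; try wfs.
have [lt|ge] := ltnP a k.
  by rewrite !cat_rcons !(jw_cup0 (m := k) jp') ?scaler0 ?addr0 //; wfs.
have ea : a = k by lia.
subst a; set X := pa_Z _ _ _ (_ ++ [:: (0%N, Box p')]).
suff -> : pa_Z P k.+2 s (rcons w1 (k, Cup) ++
    [:: (0%N, Box p'); (k, Cap); (k, Cup); (0%N, Box p')]) = c *: X.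
  by rewrite scalerA mulNr mulVf // scaleN1r addNr.
have wr : @wf (pa_space P) s k [:: (k, Cup); (0%N, Box p')] k.+2 by wfs.
transitivity (pa_Z P k.+2 s (w1 ++ (0%N, Box (partial_trace p')) :: [:: (k, Cup); (0%N, Box p')])).
  by rewrite cat_rcons /partial_trace (Z_glue0 w1P) //; wfs.
rewrite cp Z_boxZ; last by apply: wf_cat w1P _; wfs.
congr (_ *: _); rewrite /X -{2}(jw_add_stringK jp jp') mul_box; last by wfs.
rewrite (Z_glue0 w1P') ?cats0 //; try wfs.
rewrite cat_rcons.
have e : eqv s k k.+2 [:: (0%N, Box p); (k, Cup); (0%N, Box p')]
   [:: (k, Cup); (0%N, Box p); (0%N, Box p')].
  by apply: eqv_exch_cons => /=; rewrite ?/shade; lia.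
by case: e => _ _ /(_ k.+2 w1 [::] w1P (eqxx _)).
Qed.

(** The invariant is that the partial trace of [p'] is [c] times [p]: then the
  partial trace of the next element is [delta - 1 / c] times [p'], and traces
  satisfy the recursion [qint_rec] of the quantum integers.  The ratio
  [delta - 1 / c] is nonzero since otherwise the next element has trace zero, so
  vanishes by positivity, and the identity lies in [TLlow]. *)
Lemma jw_exists (q : C) n s : q != 0 -> delta P = q + q^-1 ->
  one P n.+1 s \notin TLlow P n.+1 s -> forall k, (k <= n)%N ->
  exists (p : P k s) (p' : P k.+1 s) c,
  [/\ jw p /\ jw p', partial_trace p' = c *: p, c != 0, Tr p = qint q k.+1
    & Tr p' = qint q k.+2].
Proof.
move=> q0 qd notlow; have nz k (p : P k s) : (k <= n.+1)%N -> jw p -> p != 0.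
  move=> le /jw_neq0; apply; apply: contra notlow; exact: one_low_mono.
have q1 : qint q 1 = 1.
  by rewrite /qint; case: eqVneq => [|ne] //; rewrite !expr1 divff // subr_eq0.
have q2 : qint q 2 = delta P.
  by rewrite qint_rec // q1 mulr1 qd [qint q 0]/qint /= mulr0n expr0 invr1 subrr mul0r if_same subr0.
elim=> [_|k IHk ltk].
  exists (one P 0 s), (one P 1 s), (delta P).
  have pt : partial_trace (one P 1 s) = delta P *: one P 0 s.
    by rewrite -add_string_one ptr_add_string.
  have t0 : Tr (one P 0 s) = 1 by rewrite Tr_Z //= scal_one.
  split=> //; [by split; [exact: jw_one0 | exact: jw_one1] | by rewrite t0 | ].
  by rewrite -Tr_ptr pt TrZ t0 mulr1.
have [p [p' [c [[jp jp'] cp c0 tp tp']]]] := IHk (ltnW ltk).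
have pn0 := nz _ _ (leqW (ltnW ltk)) jp.
have cR : c^* = c.
  have := congr1 star cp; have [sp _ _] := jp; have [sp' _ _] := jp'.
  rewrite star_ptr sp' starZ sp cp => /eqP; rewrite -subr_eq0 -scalerBl scaler_eq0.
  by rewrite (negbTE pn0) orbF subr_eq0 => /eqP <-.
have jf := wenzl_jw jp jp' cp c0 cR.
have pf : partial_trace (wenzl c p') = (delta P - c^-1) *: p'.
  rewrite /wenzl addrC -scaleNr ptr_lin ptr_circ ptr_add_string jw_idem //.
  by rewrite -scalerDl addrC.
have tf : Tr (wenzl c p') = qint q k.+3.
  rewrite -Tr_ptr pf TrZ qint_rec // -qd mulrBl tp' -tp; congr (_ - _).
  by rewrite -tp' -Tr_ptr cp TrZ mulKf.
exists p', (wenzl c p'), (delta P - c^-1); split=> //.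
apply/eqP => e; have := Tr_jw_gt0 jf (nz k.+2 _ ltk jf).
by rewrite -Tr_ptr pf e scale0r Tr0 ltxx.
Qed.

End Loop.
End JonesWenzl.

(** * Projection onto the Temperley-Lieb diagrams *)

Section Projection.
Context {C : numClosedFieldType} {P : subfactorPlanarAlgebra C}.
Implicit Types (s t : bool) (m r a b k j n : nat) (u v w : ptangle P).

Lemma fou_lin k s t c (x y : P k s) : t = ~~ s -> (0 < k)%N ->
  fou s t k (c *: x + y) = c *: fou s t k x + fou s t k y.
Proof. by move=> et k0; rewrite (@pa_linear _ _ _ _ [:: _]) //; exact: wf_fou. Qed.

Lemma ifou_lin k s t c (x y : P k s) : t = ~~ s -> (0 < k)%N ->
  ifou s t k (c *: x + y) = c *: ifou s t k x + ifou s t k y.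
Proof. by move=> et k0; rewrite (@pa_linear _ _ _ _ [:: _]) //; exact: wf_ifou. Qed.

Lemma perpTLP k s (x : P k s) : x \in orthocompl (TL P k s) -> perpTL x.
Proof.
move: x; apply: span_of_ind => [y _|c x y px py z zTL]; first exact: inner0.
by rewrite inner_lin px // py // mulr0 addr0.
Qed.

Lemma orthoproj_perp k s (x y : P k s) : x \in TL P k s -> perpTL y ->
  orthoproj (TL P k s) (x + y) = x.
Proof.
move=> xTL py; have yO : y \in orthocompl (TL P k s) by apply: span_of_mem.
have dir : (TL P k s :&: orthocompl (TL P k s) = 0)%VS.
  apply/eqP; rewrite -subv0; apply/subvP => z; rewrite memv_cap => /andP[zTL zO].
  by rewrite memv0; apply/eqP/inner_eq0/(perpTLP zO).
have dir' : (orthocompl (TL P k s) :&: TL P k s = 0)%VS by rewrite capvC.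
rewrite /orthoproj linearD /= daddv_pi_id //.
have := daddv_pi_add dir (subvP (addvSr _ _) _ yO).
by rewrite (daddv_pi_id dir' yO) => /(canRL (addrK _)) ->; rewrite subrr addr0.
Qed.

(** Both terms are orthogonal to [TLlow], and the coefficient is chosen to make
  the difference orthogonal to the identity as well. *)
Lemma circ_perp n s (x y : P n.+1 s) (p : P n.+2 s) :
  (forall (t' : bool) (y : P n t'), y \in TL P n t') -> perpTL x ->
  jw p -> p != 0 -> perpTL (circ x y - (Tr (mul x y) / Tr p) *: p).
Proof.
move=> full px jp p0 z /(subvP (TL_split _ _)).
case/memv_addP=> _ /vlineP[c ->] [l llow ->].
have [_ _ kill] := jp; rewrite inner_linl addrC [circ x y - _]addrC -scaleNr !inner_lin.
rewrite (TLlow_perp kill llow) (TLlow_perp (circ_TLlow y full px) llow).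
rewrite mulr0 !add0r ?addr0 /inner star_one !mul1 Tr_circ mulNr divfK ?addNr ?mulr0 //.
by rewrite gt_eqF ?Tr_jw_gt0.
Qed.

(** If the identity were a combination of diagrams that kill [circ x y], then
  [circ x y] would be zero. *)
Lemma one_notin_low n s (x y : P n.+1 s) :
  (forall (t' : bool) (y : P n t'), y \in TL P n t') -> perpTL x ->
  Tr (mul x y) != 0 -> one P n.+2 s \notin TLlow P n.+2 s.
Proof.
move=> full px; apply: contra => /(circ_TLlow y full px); rewrite mul1 => c0.
by rewrite -Tr_circ c0 Tr0.
Qed.

Lemma fourier_iter_split j k s (x y : P k s) : (0 < k)%N ->
  x \in TL P k s -> perpTL y ->
  [/\ fourier_iter j (x + y) = fourier_iter j x + fourier_iter j y,
      fourier_iter j x \in TL P k (iter j negb s) & perpTL (fourier_iter j y)].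
Proof.
move=> k0 xTL py; elim: j => //= j [-> jTL jp]; rewrite /fourier; split.
- by rewrite -[X in X + _]scale1r fou_lin // scale1r.
- exact: TL_fou.
- exact: perp_fou.
Qed.

Lemma fourier_inv_iter_split j k s (x y : P k s) : (0 < k)%N ->
  x \in TL P k s -> perpTL y ->
  [/\ fourier_inv_iter j (x + y) = fourier_inv_iter j x + fourier_inv_iter j y,
      fourier_inv_iter j x \in TL P k (iter j negb s)
      & perpTL (fourier_inv_iter j y)].
Proof.
move=> k0 xTL py; elim: j => //= j [-> jTL jp]; rewrite /fourier_inv; split.
- by rewrite -[X in X + _]scale1r ifou_lin // scale1r.
- exact: TL_ifou.
- exact: perp_ifou.
Qed.

(** Each step preserves [TL] and its orthogonal complement, by unitarity. *)
Lemma orthoproj_fourier_pow (j : int) k s (x y : P k s) : (0 < k)%N ->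
  x \in TL P k s -> perpTL y ->
  orthoproj (TL P k (iter `|j|%N negb s)) (fourier_pow j (x + y))
  = fourier_pow j (orthoproj (TL P k s) (x + y)).
Proof.
move=> k0 xTL py; rewrite (orthoproj_perp xTL py); case: j => j.
  have [e jTL jp] := fourier_iter_split j k0 xTL py.
  by rewrite /fourier_pow e; apply: orthoproj_perp.
have [e jTL jp] := fourier_inv_iter_split j.+1 k0 xTL py.
by rewrite /fourier_pow e; apply: orthoproj_perp.
Qed.

End Projection.

Local Open Scope complex_scope.

Theorem proposition4p5p2 (R : realType) (P : subfactorPlanarAlgebra R[i])
    (q : R[i]) (n e : nat) (B : seq (P n true)) (omega : P n true -> R[i])
    (q_neq0 : q != 0) (q_delta : delta P = q + q^-1)
    (n_gt0 : (0 < n)%N)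
    (annular0 : forall k : nat, (0 < k < n)%N -> annular_mult P k = 0%N)
    (annular_e : annular_mult P n = e)
    (B_basis : basis_of (orthocompl (TL P n true)) B)
    (B_orthonormal :
       forall S T : P n true, S \in B -> T \in B -> inner S T = (S == T)%:R)
    (B_selfadjoint : forall S : P n true, S \in B -> star S = S)
    (B_rotation : forall S : P n true, S \in B -> rotation S = omega S *: S) :
  forall S T : P n true, S \in B -> T \in B ->
  [/\ orthoproj (TL P n.+1 true) (circ S T)
      = (if S == T then (qint q n.+2)^-1 *: jones_wenzl P n.+1 true else 0),
      orthoproj (TL P n.+1 true) (bstar S T)
      = (if S == T
         then (omega S / qint q n.+2) *: fourier (jones_wenzl P n.+1 false)
         else 0)
    & forall j : int,
      orthoproj (TL P n.+1 (iter `|j|%N negb true)) (fourier_pow j (circ S T))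
      = fourier_pow j (orthoproj (TL P n.+1 true) (circ S T))].
Proof.
case: n => // n in B omega n_gt0 annular0 annular_e B_basis B_orthonormal
  B_selfadjoint B_rotation *.
move=> S T SB TB.
have full (t' : bool) (y : P n t') : y \in TL P n t'.
  exact: (annular0_TL annular0).
have perpB X : X \in B -> perpTL X.
  by move=> XB; apply: perpTLP; exact: basis_mem B_basis XB.
have pFS : perpTL (fourier S) by apply: perp_fou => //; apply: perpB.
have starF : star (fourier S) = fourier_inv S.
  by rewrite star_fou // B_selfadjoint.
have TrF X : X \in B -> Tr (mul (fourier S) (fourier X)) = omega X * (S == X)%:R.
  move=> XB; rewrite -B_orthonormal // -innerZ -B_rotation //.
  by rewrite /rotation [RHS]inner_fou // /inner star_ifou // B_selfadjoint.

have TrB X : X \in B -> Tr (mul S X) = (S == X)%:R.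
  by move=> XB; rewrite -B_orthonormal // /inner B_selfadjoint.
have pS := perpB S SB; have piS : perpTL (fourier_inv S) by apply: perp_ifou.
have low_t : one P n.+2 true \notin TLlow P n.+2 true.
  by apply: (one_notin_low full pS (y := S)); rewrite TrB // eqxx oner_eq0.
(* For the shaded sign, the nonzero element is [S] rotated by one click. *)
have low_f : one P n.+2 false \notin TLlow P n.+2 false.
  apply: (one_notin_low full piS (y := fourier S)).
  rewrite -starF; rewrite -[Tr _]/(inner (fourier S) (fourier S)) inner_fou //.
  by rewrite fouK // B_orthonormal // eqxx oner_eq0.
have d0 : delta P != 0.
  by apply: (@delta_neq0 _ _ true); apply: contra low_t; exact: one_low_mono.
have [_ [pt [_ [[_ jt] _ _ _ tt]]]] :=
  jw_exists d0 q_neq0 q_delta low_t (leqnn n.+1).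
have [_ [pf [_ [[_ jf] _ _ _ tf]]]] :=
  jw_exists d0 q_neq0 q_delta low_f (leqnn n.+1).
have ct := circ_perp T full pS jt (jw_neq0 jt low_t).
have cf := circ_perp (fourier T) full pFS jf (jw_neq0 jf low_f).
rewrite (jones_wenzlE d0 jt) (jones_wenzlE d0 jf).
rewrite tt TrB // in ct; rewrite tf TrF // in cf.
set a := _ / _ in ct; set b := _ / _ in cf.
have at_TL : a *: pt \in TL P n.+2 true by rewrite rpredZ ?jw_TL.
have bf_TL : b *: pf \in TL P n.+2 false by rewrite rpredZ ?jw_TL.
have -> : circ S T = a *: pt + (circ S T - a *: pt) by rewrite addrC subrK.
split; last by move=> j; apply: orthoproj_fourier_pow.
  rewrite orthoproj_perp // /a; case: eqP => _; first by rewrite mul1r.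
  by rewrite mul0r scale0r.
have -> : bstar S T = b *: fourier pf + fourier (circ (fourier S) (fourier T) - b *: pf).
  by rewrite /fourier -fou_lin // [X in Box X]addrC subrK.
rewrite orthoproj_perp /b; first last.
- exact: perp_fou.
- by rewrite rpredZ // TL_fou // jw_TL.
by case: eqP => [->|_]; rewrite ?mulr1 // mulr0 mul0r scale0r.
Qed.
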